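(* For any register $\bar q$, projectors $P,Q,R,Inv$ on $\mathcal{H}_{\bar q}$ and programs $S,S_0,S_1,S_2$, the following hold (writing $\{X\}$ for $\mathbf{assert}\ X[\bar q]$ and $[X,Y]$ for $[X,Y]_{\bar q}$): (Comm-Asst-True) $S\equiv\{I\};S\equiv S;\{I\}$. (Comm-Asst-Post) If $sp.S.P\sqsubseteq Q$ or $P\sqsubseteq wlp.S.Q$, then $\{P\};S\equiv\{P\};S;\{Q\}$. (Comm-Asst-Pre) If $sp.S.P^\perp\sqsubseteq Q^\perp$ or $P^\perp\sqsubseteq wlp.S.Q^\perp$, then $S;\{Q\}\equiv\{P\};S;\{Q\}$. (Comm-Asst-Seq) If $\{P\};S_1\equiv\{P\};S_1;\{Q\}$ and $\{Q\};S_2\equiv\{Q\};S_2;\{R\}$, then $\{P\};S_1;S_2\equiv\{P\};S_1;\{Q\};S_2;\{R\}$. (Wpc-Asst-Pres) $\{P\};[Q,R]\equiv\{P\};[P\rightsquigarrow Q,R]$. (Wpc-Asst-Cond) If $S_1;\{R\}\equiv\{P\rightsquigarrow Q\};S_1;\{R\}$ and $S_0;\{R\}\equiv\{P^\perp\rightsquigarrow Q\};S_0;\{R\}$, then $\mathbf{if}\ P[\bar q]\ \mathbf{then}\ S_1\ \mathbf{else}\ S_0\ \mathbf{end};\{R\}\equiv\{Q\};\mathbf{if}\ P[\bar q]\ \mathbf{then}\ \{P\rightsquigarrow Q\};S_1\ \mathbf{else}\ \{P^\perp\rightsquigarrow Q\};S_0\ \mathbf{end};\{R\}$. (Wpc-Asst-While)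 If $S;\{Q\}\equiv\{P\rightsquigarrow Q\};S;\{Q\}$, then $\mathbf{while}\ P[\bar q]\ \mathbf{do}\ S\ \mathbf{end};\{P^\perp\rightsquigarrow Q\}\equiv\{Q\};\mathbf{while}\ P[\bar q]\ \mathbf{do}\ \{P\rightsquigarrow Q\};S;\{Q\}\ \mathbf{end};\{P^\perp\rightsquigarrow Q\}$. (Spc-Asst-Post) $\{P\};\{Q\}\equiv\{P\};\{Q\};\{Q\Cap P\}\equiv\{P\Cap Q\};\{P\};\{Q\}$. (Spc-Asst-Pres) $[Q,R];\{P\}\equiv[Q,P\Cap R];\{P\}$. (Spc-Asst-Cond) If $\{P\Cap Q\};S_1\equiv\{P\Cap Q\};S_1;\{R\}$ and $\{P^\perp\Cap Q\};S_0\equiv\{P^\perp\Cap Q\};S_0;\{R\}$, then $\{Q\};\mathbf{if}\ P[\bar q]\ \mathbf{then}\ S_1\ \mathbf{else}\ S_0\ \mathbf{end}\equiv\{Q\};\mathbf{if}\ P[\bar q]\ \mathbf{then}\ \{P\Cap Q\};S_1\ \mathbf{else}\ \{P^\perp\Cap Q\};S_0\ \mathbf{end};\{R\}$. (Spc-Asst-While) If $\{P\Cap Inv\};S\equiv\{P\Cap Inv\};S;\{Inv\}$, then $\{Inv\};\mathbf{while}\ P[\bar q]\ \mathbf{do}\ S\ \mathbf{end}\equiv\{Inv\};\mathbf{while}\ P[\bar q]\ \mathbf{do}\ \{P\Cap Inv\};S;\{Inv\}\ \mathbf{end};\{P^\perp\Cap Inv\}$.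
   Context: $V$ finite set of qubit variables, $\mathcal{H}_W=\bigotimes_{q\in W}\mathcal{H}_q$, $\mathcal{H}_q\cong\mathbb{C}^2$; operators on subsystems identified with their extension by identity to $\mathcal{H}_V$. Projectors identified with subspaces; $\sqsubseteq$ inclusion; $\wedge,\vee$ meet and join; $P^\perp$ orthocomplement; $I$ the identity/whole space. Sasaki implication $P\rightsquigarrow Q=P^\perp\vee(P\wedge Q)$, Sasaki conjunction $P\Cap Q=P\wedge(P^\perp\vee Q)$. $\rho\models P$ iff the support of $\rho$ is contained in $P$. Programs: $S::=\mathbf{skip}\mid\mathbf{abort}\mid \bar q:=0\mid \bar q \mathrel{*}= U\mid \mathbf{assert}\ P[\bar q]\mid [P,Q]_{\bar q}\mid S_0\oplus_p S_1\mid S_0;S_1\mid \mathbf{if}\ P[\bar q]\ \mathbf{then}\ S_1\ \mathbf{else}\ S_0\ \mathbf{end}\mid \mathbf{while}\ P[\bar q]\ \mathbf{do}\ S\ \mathbf{end}$ with denotations (sets of super-operators): $\{\mathrm{id}\}$, $\{0\}$, $\{\rho\mapsto\sum_i|0\rangle_{\bar q}\langle i|\rho|i\rangle_{\bar q}\langle 0|\}$, $\{\rho\mapsto U\rho U^\dagger\}$, $\{\rho\mapsto P\rho P\}$, $\{\mathcal{E}$ completely positive trace-nonincreasing on $\mathcal{H}_{\bar q}:\forall\rho\models P,\mathcal{E}(\rho)\models Q\}$, $\{p\mathcal{E}_0+(1-p)\mathcal{E}_1\}$, $\{\mathcal{E}_1\circ\mathcal{E}_0\}$, $\{\mathcal{E}_1\circ\mathcal{P}+\mathcal{E}_0\circ\mathcal{P}^\perp\}$,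 $\{\sum_{k\ge0}\mathcal{P}^\perp\circ\mathcal{E}_k\circ\mathcal{P}\circ\cdots\circ\mathcal{E}_1\circ\mathcal{P}\}$ respectively, with $\mathcal{E}_i\in\llbracket S_i\rrbracket$ (resp. $\llbracket S\rrbracket$) chosen independently, $\mathcal{P}(\rho)=P\rho P$, $\mathcal{P}^\perp(\rho)=P^\perp\rho P^\perp$. $\models\{P\}S\{Q\}$ (Hoare triple, not to be confused with the assertion statement) iff for all partial density operators $\rho$ on $\mathcal{H}_V$ and $\mathcal{E}\in\llbracket S\rrbracket$, $\rho\models P\Rightarrow\mathcal{E}(\rho)\models Q$. $wlp.S.Q$ is the (existing) $\sqsubseteq$-greatest $P$ with $\models\{P\}S\{Q\}$; $sp.S.P$ the (existing) $\sqsubseteq$-least $Q$ with $\models\{P\}S\{Q\}$. $S\sqsubseteq S'$ iff for all projectors $P,Q$, $\models\{P\}S\{Q\}\Rightarrow\models\{P\}S'\{Q\}$; $S\equiv S'$ iff both $S\sqsubseteq S'$ and $S'\sqsubseteq S$. *)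

(* Defs.v *)
From HB Require Import structures.
From mathcomp Require Import all_boot all_order all_algebra.
From mathcomp Require Import complex Rstruct.
From Stdlib Require Rdefinitions Rseries ClassicalEpsilon.

Set Implicit Arguments.
Unset Strict Implicit.
Unset Printing Implicit Defensive.

Import Order.TTheory GRing.Theory Num.Theory Num.Def.
Local Open Scope ring_scope.

Notation Rl := Rdefinitions.R.
Notation C := (Rl[i]).

Section Generic.
Variable n : nat.
Implicit Types A P Q rho : 'M[C]_n.

Definition adj m k (A : 'M[C]_(m, k)) : 'M[C]_(k, m) := (map_mx conjC A)^T.

Definition psd A : Prop := forall v : 'rV[C]_n, 0 <= (v *m A *m adj v) 0 0.
Definition pdo rho : Prop := psd rho /\ \tr rho <= 1.
Definition is_proj P : Prop := adj P = P /\ P *m P = P.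
(* rho |= P : the support of rho is contained in (the subspace of) P *)
Definition models rho P : Prop := (rho <= P)%MS.
Definition le P Q : Prop := (P <= Q)%MS.
Definition pmeet P Q : 'M[C]_n := proj_ortho (P :&: Q)%MS.
Definition pjoin P Q : 'M[C]_n := proj_ortho (P + Q)%MS.
Definition orth P : 'M[C]_n := 1%:M - P.
Definition sasaki_imp P Q := pjoin (orth P) (pmeet P Q).
Definition sasaki_conj P Q := pmeet P (pjoin (orth P) Q).

End Generic.

Definition cp (n : nat) (E : 'M[C]_n -> 'M[C]_n) : Prop :=
  (forall (a : C) A B, E (a *: A + B) = a *: E A + E B) /\
  forall (k : nat) (rho : 'M[C]_(\sum_(i < k) n)), psd rho ->
    psd (\mxblock_(i < k, j < k) E (submxblock (p_ := fun _ : 'I_k => n)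
                                                (q_ := fun _ : 'I_k => n) rho i j)).
Definition tni (n : nat) (E : 'M[C]_n -> 'M[C]_n) : Prop :=
  forall rho : 'M[C]_n, psd rho -> \tr (E rho) <= \tr rho.

Section Quantum.
Variable V : finType.

(* computational basis of H_V *)
Definition BV := {ffun V -> bool}.
Definition gdim := #|{: BV}|.
Definition gval (i : 'I_gdim) : BV := enum_val i.
Definition gidx (s : BV) : 'I_gdim := enum_rank s.

(* register qbar given as a set of qubit variables; basis of H_qbar *)
Definition reg (W : {set V}) : finType := {x : V | x \in W}.
Definition BW (W : {set V}) := {ffun reg W -> bool}.
Definition ldim (W : {set V}) := #|{: BW W}|.
Definition lval W (i : 'I_(ldim W)) : BW W := enum_val i.
Definition lidx W (a : BW W) : 'I_(ldim W) := enum_rank a.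

Definition restr W (s : BV) : BW W := [ffun y => s (val y)].
Definition merge W (a : BW W) (s : BV) : BV :=
  [ffun x => match (insub x : option (reg W)) with Some y => a y | None => s x end].

(* extension A (x) I of an operator on H_W to H_V *)
Definition ext W (A : 'M[C]_(ldim W)) : 'M[C]_gdim :=
  \matrix_(i, j) (A (lidx (restr W (gval i))) (lidx (restr W (gval j))) *
                  [forall x, (x \notin W) ==> (gval i x == gval j x)]%:R).

(* extension E (x) id of a super-operator on H_W to H_V *)
Definition block W (rho : 'M[C]_gdim) (s t : BV) : 'M[C]_(ldim W) :=
  \matrix_(a, b) rho (gidx (merge (lval a) s)) (gidx (merge (lval b) t)).
Definition ext_sop W (E : 'M[C]_(ldim W) -> 'M[C]_(ldim W)) :
  'M[C]_gdim -> 'M[C]_gdim :=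
  fun rho => \matrix_(i, j)
    E (block W rho (gval i) (gval j)) (lidx (restr W (gval i))) (lidx (restr W (gval j))).

Definition sop := 'M[C]_gdim -> 'M[C]_gdim.

Definition mx_cvg (u : nat -> 'M[C]_gdim) (L : 'M[C]_gdim) : Prop :=
  forall i j, Rseries.Un_cv (fun N => complex.Re (u N i j)) (complex.Re (L i j)) /\
              Rseries.Un_cv (fun N => complex.Im (u N i j)) (complex.Im (L i j)).

Inductive prog : Type :=
| Skip
| Abort
| Init (W : {set V})
| Unit (W : {set V}) (U : 'M[C]_(ldim W))
| Assert (W : {set V}) (P : 'M[C]_(ldim W))
| Spec (W : {set V}) (P Q : 'M[C]_(ldim W))
| PChoice (p : Rl) (S0 S1 : prog)
| Seq (S0 S1 : prog)
| Cond (W : {set V}) (P : 'M[C]_(ldim W)) (S1 S0 : prog)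
| While (W : {set V}) (P : 'M[C]_(ldim W)) (S : prog).

Fixpoint wf (S : prog) : Prop :=
  match S with
  | Skip | Abort | Init _ => True
  | Unit _ U => U \is unitarymx
  | Assert _ P => is_proj P
  | Spec _ P Q => is_proj P /\ is_proj Q
  | PChoice p S0 S1 => (0 <= p <= 1)%R /\ wf S0 /\ wf S1
  | Seq S0 S1 => wf S0 /\ wf S1
  | Cond _ P S1 S0 => is_proj P /\ wf S1 /\ wf S0
  | While _ P S1 => is_proj P /\ wf S1
  end.

Definition zero_asg W : BW W := [ffun _ => false].

(* k-th iterate of the loop body E_k o P o ... o E_1 o P (Es 0 = E_1) *)
Fixpoint loop_iter (Pm : 'M[C]_gdim) (Es : nat -> sop) (k : nat) (rho : 'M[C]_gdim) :=
  match k with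
  | 0 => rho
  | k'.+1 => Es k' (Pm *m loop_iter Pm Es k' rho *m Pm)
  end.

Fixpoint den (S : prog) : sop -> Prop :=
  match S with
  | Skip => fun E => E = id
  | Abort => fun E => E = fun _ => 0
  | Init W => fun E => E = fun rho =>
      \sum_(k < ldim W) ext (delta_mx (lidx (zero_asg W)) k) *m rho
                          *m adj (ext (delta_mx (lidx (zero_asg W)) k))
  | Unit W U => fun E => E = fun rho => ext U *m rho *m adj (ext U)
  | Assert W P => fun E => E = fun rho => ext P *m rho *m ext P
  | Spec W P Q => fun E => exists F : 'M[C]_(ldim W) -> 'M[C]_(ldim W),
      [/\ cp F, tni F,
          (forall rho, pdo rho -> models rho P -> models (F rho) Q) &
          E = ext_sop F]
  | PChoice p S0 S1 => fun E => exists E0 E1, [/\ den S0 E0, den S1 E1 &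
      E = fun rho => (p%:C)%C *: E0 rho + ((1 - p)%:C)%C *: E1 rho]
  | Seq S0 S1 => fun E => exists E0 E1, [/\ den S0 E0, den S1 E1 & E = E1 \o E0]
  | Cond W P S1 S0 => fun E => exists E1 E0, [/\ den S1 E1, den S0 E0 &
      E = fun rho => E1 (ext P *m rho *m ext P)
                     + E0 (orth (ext P) *m rho *m orth (ext P))]
  | While W P S1 => fun E => exists Es : nat -> sop, (forall k, den S1 (Es k)) /\
      forall rho, mx_cvg (fun N => \sum_(k < N)
                    orth (ext P) *m loop_iter (ext P) Es k rho *m orth (ext P))
                  (E rho)
  end.

Definition hoare (P : 'M[C]_gdim) (S : prog) (Q : 'M[C]_gdim) : Prop :=
  forall rho E, pdo rho -> den S E -> models rho P -> models (E rho) Q.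

Definition wlp (S : prog) (Q : 'M[C]_gdim) : 'M[C]_gdim :=
  ClassicalEpsilon.epsilon (inhabits 0) (fun W =>
    [/\ is_proj W, hoare W S Q &
        forall P, is_proj P -> hoare P S Q -> le P W]).
Definition sp (S : prog) (P : 'M[C]_gdim) : 'M[C]_gdim :=
  ClassicalEpsilon.epsilon (inhabits 0) (fun W =>
    [/\ is_proj W, hoare P S W &
        forall Q, is_proj Q -> hoare P S Q -> le W Q]).

Definition refines (S S' : prog) : Prop :=
  forall P Q, is_proj P -> is_proj Q -> hoare P S Q -> hoare P S' Q.
Definition pequiv (S S' : prog) : Prop := refines S S' /\ refines S' S.

End Quantum.

Arguments Skip {V}.
Arguments Abort {V}.
Arguments Init {V} W.
Arguments Unit {V} W U.
Arguments Assert {V} W P.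
Arguments Spec {V} W P Q.
Arguments PChoice {V} p S0 S1.
Arguments Seq {V} S0 S1.
Arguments Cond {V} W P S1 S0.
Arguments While {V} W P S.

(* Main.v *)
(* A subspace is given by the row space of any matrix [X] spanning it. Every
   denotation is a trace-nonincreasing positive linear map [E], and for such maps
   the support of [E rho] over all [rho |= X] is largest at [rho = X^* X].
   Hence a program [S] acts on subspaces by a join-preserving map [post S] (its
   strongest postcondition), and equivalence of programs is equality of these maps.
   [post] is compositional: sequencing is composition, [assert P] sends [X] to
   [X P], a conditional sends [X] to [post S1 (X P) + post S0 (X P^perp)], and a
   loop sends [X] to the join over [k] of [(post S o P)^k X P^perp]. The last point
   uses that the partial sums of a loop form an increasing sequence of positive
   operators of bounded trace, so they converge and their limit dominates each term.
   The laws then reduce to matrix identities such as [P (P ~> Q) = P /\ Q] and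
   [Q P (P doublecap Q) = Q P]. For the two laws on specification statements, an
   element of one denotation is turned into an element of the other by conjugating
   with an oblique projection, rescaled to keep the trace from increasing. *)

Require Import Defs.
From HB Require Import structures.
From mathcomp Require Import all_boot all_order all_algebra.
From mathcomp Require Import complex Rstruct.
From mathcomp Require Import spectral ring.
From Stdlib Require Rdefinitions Rfunctions Rseries Rcomplete SeqProp Classical ClassicalEpsilon.
Set Implicit Arguments.
Unset Strict Implicit.
Unset Printing Implicit Defensive.
Import Order.TTheory GRing.Theory Num.Theory.
Local Open Scope ring_scope.

(** * Positive matrices *)

(** Triples compare supports only, so a nonzero scalar factor is invisible; this is the room in
    which the specification laws hold, without matching the two denotations element by element.

    A denotation is a possibly infinite set, and the subspace reached by a program is a join over
    all its elements. Such a join is pushed through the next statement by adjunction: each [Y] has a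
    weakest [Z] such that [post S X <= Y] iff [X <= Z]. Both the join and the adjoint exist for
    reasons of dimension, since a family of subspaces containing 0 and closed under sums has a
    largest member.

    Varying one component of a compound program while the others stay fixed requires every
    denotation to be inhabited. For a loop this means a limit on every matrix, positive or not;
    linearity and polarization reduce it to positive ones.

    Complete positivity enters to make the extension of a local map by the identity positive on the
    whole space. Positivity is stated by the quadratic form alone, so Hermitian symmetry has to be
    derived. The linear algebra is done over any [numClosedFieldType]; real analysis enters with the
    limits. *)

Section ConjugateTranspose.
Variable F : numClosedFieldType.

(* At [F = R[i]], [ctmx] and [psdmx], and [projmx], [extmx], [extmap], [cpmx],
   [tnimx], [specmx] below, are convertible to [adj], [psd], [is_proj], [ext],
   [ext_sop], [cp], [tni] and the condition in the denotation of [Spec]. *)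
Definition ctmx m k (A : 'M[F]_(m, k)) : 'M[F]_(k, m) := (map_mx Num.conj A)^T.

Definition psdmx n (A : 'M[F]_n) : Prop :=
  forall v : 'rV[F]_n, 0 <= (v *m A *m ctmx v) 0 0.

Lemma conj_ge0 (x : F) : 0 <= x -> x^* = x.
Proof. by move=> x0; apply/CrealP/ger0_real. Qed.

Lemma ctmxE m n (A : 'M[F]_(m, n)) i j : ctmx A i j = (A j i)^*.
Proof. by rewrite !mxE. Qed.

Lemma ctmxK m n (A : 'M[F]_(m, n)) : ctmx (ctmx A) = A.
Proof. by apply/matrixP=> i j; rewrite !ctmxE conjCK. Qed.

Lemma ctmxM m n p (A : 'M[F]_(m, n)) (B : 'M[F]_(n, p)) :
  ctmx (A *m B) = ctmx B *m ctmx A.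
Proof. by rewrite /ctmx map_mxM trmx_mul. Qed.

Lemma ctmxD m n (A B : 'M[F]_(m, n)) : ctmx (A + B) = ctmx A + ctmx B.
Proof. by rewrite /ctmx map_mxD raddfD. Qed.

Lemma ctmxN m n (A : 'M[F]_(m, n)) : ctmx (- A) = - ctmx A.
Proof. by apply/matrixP=> i j; rewrite !mxE rmorphN. Qed.

Lemma ctmxZ m n a (A : 'M[F]_(m, n)) : ctmx (a *: A) = a^* *: ctmx A.
Proof. by apply/matrixP=> i j; rewrite !mxE rmorphM. Qed.

Lemma ctmx1 n : ctmx (1%:M : 'M[F]_n) = 1%:M.
Proof. by rewrite /ctmx map_mx1 trmx1. Qed.

Lemma ctmx0 m n : ctmx (0 : 'M[F]_(m, n)) = 0.
Proof. by rewrite /ctmx map_mx0 trmx0. Qed.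

Lemma ctmx_eq0 m n (A : 'M[F]_(m, n)) : ctmx A = 0 -> A = 0.
Proof. by move=> /(congr1 (@ctmx _ _)); rewrite ctmxK ctmx0. Qed.

Lemma dotmx_sum n (u : 'rV[F]_n) : (u *m ctmx u) 0 0 = \sum_i `|u 0 i| ^+ 2.
Proof. by rewrite mxE; apply: eq_bigr => i _; rewrite ctmxE normCK. Qed.

Lemma dotmx_ge0 n (u : 'rV[F]_n) : 0 <= (u *m ctmx u) 0 0.
Proof. by rewrite dotmx_sum sumr_ge0 // => i _; rewrite exprn_ge0. Qed.

Lemma dotmx_eq0 n (u : 'rV[F]_n) : (u *m ctmx u) 0 0 = 0 -> u = 0.
Proof.
rewrite dotmx_sum => /eqP; rewrite psumr_eq0 => [|i _]; last exact: exprn_ge0.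
move=> /allP u0; apply/rowP=> i; rewrite mxE.
have := u0 i (mem_index_enum i).
by rewrite /= expf_eq0 /= normr_eq0 => /eqP.
Qed.

Lemma mx11_ctmx (A : 'M[F]_1) : ctmx A 0 0 = (A 0 0)^*.
Proof. exact: ctmxE. Qed.

Section Psd.
Variable n : nat.
Implicit Types (A B : 'M[F]_n) (v : 'rV[F]_n).

Lemma psdmx0 : psdmx (0 : 'M[F]_n).
Proof. by move=> v; rewrite mulmx0 mul0mx mxE. Qed.

Lemma psdmxD A B : psdmx A -> psdmx B -> psdmx (A + B).
Proof. by move=> pA pB v; rewrite mulmxDr mulmxDl mxE addr_ge0. Qed.

Lemma psdmxZ a A : 0 <= a -> psdmx A -> psdmx (a *: A).
Proof. by move=> a0 pA v; rewrite -scalemxAr -scalemxAl mxE mulr_ge0. Qed.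

Lemma psdmx_sum (I : Type) (r : seq I) (p : pred I) (G : I -> 'M[F]_n) :
  (forall i, psdmx (G i)) -> psdmx (\sum_(i <- r | p i) G i).
Proof.
by move=> pG; apply: big_ind => // [|A B]; [apply: psdmx0 | apply: psdmxD].
Qed.

Lemma psdmx_conj m (X : 'M[F]_(n, m)) A : psdmx A -> psdmx (ctmx X *m A *m X).
Proof.
move=> pA v; rewrite !mulmxA -[_ *m X *m _]mulmxA.
have -> : X *m ctmx v = ctmx (v *m ctmx X) by rewrite ctmxM ctmxK.
exact: pA.
Qed.

Lemma psdmx1 : psdmx (1%:M : 'M[F]_n).
Proof. by move=> v; rewrite mulmx1 dotmx_ge0. Qed.

End Psd.

Lemma psdmx_gram m n (X : 'M[F]_(m, n)) : psdmx (ctmx X *m X).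
Proof. by rewrite -[ctmx X]mulmx1; apply/psdmx_conj/psdmx1. Qed.

Section PsdForms.
Variable n : nat.
Implicit Types (A B : 'M[F]_n) (u v : 'rV[F]_n).

Lemma qfD A u v : ((u + v) *m A *m ctmx (u + v)) 0 0 =
  (u *m A *m ctmx u) 0 0 + (u *m A *m ctmx v) 0 0
  + (v *m A *m ctmx u) 0 0 + (v *m A *m ctmx v) 0 0.
Proof. by rewrite ctmxD !mulmxDl !mulmxDr !mxE; ring. Qed.

Lemma qfZl A a u v : ((a *: u) *m A *m ctmx v) 0 0 = a * (u *m A *m ctmx v) 0 0.
Proof. by rewrite -!scalemxAl mxE. Qed.

Lemma qfZr A a u v : (u *m A *m ctmx (a *: v)) 0 0 = a^* * (u *m A *m ctmx v) 0 0.
Proof. by rewrite ctmxZ -scalemxAr mxE. Qed.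

Lemma qf_delta A i j :
  ((delta_mx 0 i : 'rV[F]_n) *m A *m ctmx (delta_mx 0 j : 'rV[F]_n)) 0 0 = A i j.
Proof.
rewrite -rowE mxE (bigD1 j) //= ctmxE !mxE !eqxx conjC1 mulr1 big1 ?addr0 // => k kj.
by rewrite ctmxE !mxE (negbTE kj) conjC0 mulr0.
Qed.

(** Scalar core of polarization: [a], [b] are the diagonal values of a sesquilinear form at two
    vectors, [x], [y] its two cross values. Reality at the sum of the vectors gives opposite
    imaginary parts; reality after twisting one vector by ['i] gives equal real parts. *)
Lemma conj_swap (a b x y : F) : a^* = a -> b^* = b ->
  (a + x + y + b)^* = a + x + y + b ->
  (a + 'i^* * x + 'i * y + 'i * ('i^* * b))^* =
    a + 'i^* * x + 'i * y + 'i * ('i^* * b) -> x^* = y.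
Proof.
move=> ra rb; rewrite !raddfD /= !rmorphM /= !conjCK ra rb !conjCi.
move: (x^*) (y^*) => x' y' e1 e2.
have i0 : 'i != 0 :> F by rewrite neq0Ci.
have d1 : x' + y' - (x + y) = 0.
  by rewrite -(subrr (a + x + y + b)) -[X in _ = X - _]e1; ring.
have d2 : x' - y' - (y - x) = 0.
  apply: (mulfI i0); rewrite mulr0 -(subrr (a + - 'i * x + 'i * y + 'i * (- 'i * b))).
  by rewrite -[X in _ = X - _]e2; ring.
apply: (@mulIf _ 2%:R); first by rewrite pnatr_eq0.
apply/eqP; rewrite -subr_eq0; apply/eqP.
by rewrite -[RHS](addr0 0) -{1}d1 -d2; ring.
Qed.

Lemma psdmx_adj A : psdmx A -> ctmx A = A.
Proof.
move=> pA; have r (w : 'rV[F]_n) : ((w *m A *m ctmx w) 0 0)^* = (w *m A *m ctmx w) 0 0.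
  exact/conj_ge0/pA.
have sw (v u : 'rV[F]_n) : ((v *m A *m ctmx u) 0 0)^* = (u *m A *m ctmx v) 0 0.
  apply: (conj_swap (r v) (r u)); first by have := r (v + u); rewrite qfD.
  by have := r (v + 'i *: u); rewrite qfD !(qfZl, qfZr).
apply/matrixP=> i j; rewrite ctmxE; have := sw (delta_mx 0 j) (delta_mx 0 i).
by rewrite (qf_delta A j i) (qf_delta A i j).
Qed.

(** At [v + t y] with [y = v A] and [t] real, the form takes the value [2 t s + t^2 q], which is
    negative for small negative [t] unless [s = 0]. The step [- s / (q + 1)] is small enough and
    also covers [q = 0]. *)
Lemma psdmx_ker A v : psdmx A -> (v *m A *m ctmx v) 0 0 = 0 -> v *m A = 0.
Proof.
move=> pA v0; have hA := psdmx_adj pA.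
set y := v *m A; set s := (y *m ctmx y) 0 0; set q := (y *m A *m ctmx y) 0 0.
have s0 : 0 <= s by exact: dotmx_ge0.
have q0 : 0 <= q by exact: pA.
have q1 : 0 < q + 1 by rewrite ltr_wpDl.
suff: s = 0 by exact: dotmx_eq0.
have e1 : (v *m A *m ctmx y) 0 0 = s by [].
have e2 : (y *m A *m ctmx v) 0 0 = s.
  by rewrite /s {2}/y ctmxM hA mulmxA.
have rt : (- s / (q + 1))^* = - s / (q + 1).
  by rewrite mulNr rmorphN /= conj_ge0 // divr_ge0 // ltW.
have := pA (v + (- s / (q + 1)) *: y).
rewrite qfD v0 !(qfZl, qfZr) e1 e2 -/q rt add0r => H.
clearbody s q; have e : - s / (q + 1) * s + - s / (q + 1) * s +
   - s / (q + 1) * (- s / (q + 1) * q) = - (s ^+ 2 * ((q + 2%:R) / (q + 1) ^+ 2)).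
  by field; rewrite gt_eqF.
rewrite e oppr_ge0 in H.
have c0 : 0 < (q + 2%:R) / (q + 1) ^+ 2.
  by rewrite divr_gt0 ?exprn_gt0 // ltr_wpDl // ltr0n.
rewrite pmulr_lle0 // in H.
have : s ^+ 2 == 0 by rewrite eq_le H exprn_ge0.
by rewrite expf_eq0 /= => /eqP.
Qed.

(** The range of a Hermitian matrix is the orthogonal complement of its kernel, so inclusions
    between kernels reverse into inclusions between ranges. *)
Lemma hermitian_submx A B : ctmx A = A -> ctmx B = B ->
  (forall v, v *m B = 0 -> v *m A = 0) -> (A <= B)%MS.
Proof.
move=> hA hB H; rewrite submxE; apply/eqP/ctmx_eq0.
rewrite ctmxM hA; apply/row_matrixP=> i; rewrite row_mul row0.
by apply: H; apply/eqP; rewrite -row_mul -{2}hB -ctmxM mulmx_coker ctmx0 row0 eqxx.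
Qed.

(** On the kernel of [B] the form of [A] is squeezed to zero, and [psdmx_ker] applies. This is how
    operator inequalities become inclusions of supports. *)
Lemma psdmx_le_submx A B : psdmx A -> psdmx (B - A) -> (A <= B)%MS.
Proof.
move=> pA pBA; have pB : psdmx B by rewrite -(subrK A B); apply: psdmxD.
apply: hermitian_submx; rewrite ?psdmx_adj // => v vB.
apply: psdmx_ker => //; apply/eqP; rewrite eq_le; apply/andP; split; last exact: pA.
have := pBA v; rewrite mulmxBr vB sub0r mulNmx mxE oppr_ge0.
by [].
Qed.

(* Cauchy-Schwarz for the form of [A], in the shape of an operator inequality. *)
Lemma psdmx_rank1_dominated A u : psdmx A ->
  exists2 c : F, 0 <= c & psdmx (c *: A - ctmx (u *m A) *m (u *m A)).
Proof.
move=> pA; have hA := psdmx_adj pA.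
exists ((u *m A *m ctmx u) 0 0) => // x; set q := (u *m A *m ctmx u) 0 0.
have q0 : 0 <= q by exact: pA.
set a := (x *m A *m ctmx x) 0 0; set b := (x *m A *m ctmx u) 0 0.
have b' : (u *m A *m ctmx x) 0 0 = b^* by rewrite -mx11_ctmx !ctmxM ctmxK hA mulmxA.
have -> : (x *m (q *: A - ctmx (u *m A) *m (u *m A)) *m ctmx x) 0 0 = q * a - b * b^*.
  rewrite mulmxBr mulmxBl -scalemxAr -scalemxAl [LHS]mxE [X in X + _]mxE [X in _ + X]mxE.
  congr (_ - _); rewrite ctmxM hA !mulmxA [x *m A *m ctmx u]mx11_scalar -/b.
  by rewrite mul_scalar_mx -!scalemxAl mxE b'.
have [q_eq0|qN0] := eqVneq q 0.
  have uA : u *m A = 0 by exact: psdmx_ker.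
  have bc : b^* = 0 by rewrite -b' uA mul0mx mxE.
  by rewrite q_eq0 bc mulr0 mul0r subr0.
have qp : 0 < q by rewrite lt_def qN0.
have rq : q^* = q by exact: conj_ge0.
have := pA (q *: x + (- b) *: u).
rewrite qfD !(qfZl, qfZr) -/a -/b b' -/q rq rmorphN /=.
clearbody a b q; have -> : q * (q * a) + q * (- b^* * b) + q * (- b * b^*) +
   - b * (- b^* * q) =
  q * (q * a - b * b^*) by ring.
by rewrite pmulr_rge0.
Qed.

Lemma psdmx_diag A i : psdmx A -> 0 <= A i i.
Proof. by move=> pA; rewrite -qf_delta; apply: pA. Qed.

Lemma psdmx_trace_ge0 A : psdmx A -> 0 <= \tr A.
Proof. by move=> pA; apply: sumr_ge0 => i _; apply: psdmx_diag. Qed.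

Lemma psdmx_entry A i j : psdmx A -> `|A i j| <= \tr A.
Proof.
move=> pA; have hA := psdmx_adj pA.
have hji : A j i = (A i j)^* by rewrite -{1}hA ctmxE.
have [->|Aij] := eqVneq (A i j) 0; first by rewrite normr0 psdmx_trace_ge0.
have t (x y : 'I_n) : psdmx A -> x != y -> A x x + A y y <= \tr A.
  move=> _ xy; rewrite /mxtrace (bigD1 x) //= lerD2l (bigD1 y) 1?eq_sym //=.
  by rewrite lerDl sumr_ge0 // => k _; apply: psdmx_diag.
have [<-|ij] := eqVneq i j.
  rewrite ger0_norm ?psdmx_diag // /mxtrace (bigD1 i) //= lerDl.
  by rewrite sumr_ge0 // => k _; apply: psdmx_diag.
(* With [z] the phase of the entry, the test vector [e_i - z e_j] gives
   [2 |A i j| <= A i i + A j j], and for [i != j] the right side is at most the trace. *)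
set z := A i j / `|A i j|.
have nz : `|A i j| != 0 by rewrite normr_eq0.
have rn : (`|A i j|)^* = `|A i j| by exact: conj_ge0.
have zz : z * z^* = 1.
  by rewrite -normCK normrM normfV normr_id divff ?expr1n.
have zA : z^* * A i j = `|A i j|.
  rewrite /z rmorphM fmorphV /= rn mulrAC -[_^* * _]mulrC -normCK expr2.
  by rewrite -mulrA divff ?mulr1.
have Az : z * (A i j)^* = `|A i j| by rewrite -rn -zA rmorphM /= conjCK.
have := pA (delta_mx 0 i - z *: delta_mx 0 j).
rewrite qfD -scaleNr !(qfZl, qfZr) !qf_delta.
rewrite rmorphN mulrA mulrNN zz mul1r hji mulNr zA mulNr Az => H.
have ts := t i j pA ij.
have : `|A i j| + `|A i j| <= A i i + A j j.
  by rewrite -subr_ge0; apply: le_trans H _; rewrite le_eqVlt; apply/orP; left; apply/eqP; ring.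
move=> /le_trans /(_ ts) H2; apply: le_trans H2; by rewrite lerDl.
Qed.

End PsdForms.

Section Span.
Variable n : nat.

(** Reduces statements stable under linear combinations to positive rank-one matrices, where
    operator order and trace bounds are available. *)
Lemma rank1_span_ind (Pr : 'M[F]_n -> Prop) :
  (forall a A B, Pr A -> Pr B -> Pr (a *: A + B)) ->
  (forall u : 'rV[F]_n, Pr (ctmx u *m u)) -> forall A, Pr A.
Proof.
move=> lin rk A.
have P0 : Pr 0 by have := rk 0; rewrite mulmx0.
have PZ a B : Pr B -> Pr (a *: B) by move=> pB; rewrite -[_ *: B]addr0; apply: lin.
have PD B B' : Pr B -> Pr B' -> Pr (B + B').
  by move=> pB pB'; rewrite -[B]scale1r; apply: lin.
have PB B B' : Pr B -> Pr B' -> Pr (B - B').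
  by move=> pB pB'; rewrite -scaleN1r; apply/PD/PZ.
(* Polarization. *)
have pol (x y : 'rV[F]_n) : Pr (ctmx x *m y).
  set sq := fun u : 'rV[F]_n => ctmx u *m u.
  have -> : ctmx x *m y = 2%:R^-1 *: ((sq (x + y) - sq x - sq y) -
     'i *: (sq (x + 'i *: y) - sq x - sq y)).
    have e1 : sq (x + y) - sq x - sq y = ctmx x *m y + ctmx y *m x.
      rewrite /sq ctmxD mulmxDl !mulmxDr; apply/matrixP=> i j; rewrite !mxE; ring.
    have e2 : sq (x + 'i *: y) - sq x - sq y = 'i *: (ctmx x *m y - ctmx y *m x).
      rewrite /sq ctmxD ctmxZ mulmxDl !mulmxDr -!scalemxAr -!scalemxAl conjCi.
      rewrite scalerA mulrN -expr2 sqrCi opprK scale1r scaleNr.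
      by apply/matrixP=> i j; rewrite !mxE; ring.
    rewrite e1 e2 scalerA -expr2 sqrCi scaleN1r opprK.
    by apply/matrixP=> i j; rewrite !mxE; field.
  have Psq u : Pr (sq u) by exact: rk.
  by apply/PZ/PB; [|apply: PZ]; do 2!apply: (PB _ _ _ (Psq _)).
rewrite (matrix_sum_delta A); apply: big_ind => // i _; apply: big_ind => // j _.
apply: PZ; have -> : delta_mx i j = ctmx ('e_i : 'rV[F]_n) *m 'e_j :> 'M[F]_n.
  apply/matrixP=> k l; rewrite [RHS]mxE big_ord1 ctmxE !mxE !eqxx rmorph_nat.
  by rewrite -natrM mulnb.
exact: pol.
Qed.

End Span.

End ConjugateTranspose.

(** * Projections and positive maps *)

Section Projections.
Variable F : numClosedFieldType.

Definition projmx n (P : 'M[F]_n) : Prop := ctmx P = P /\ P *m P = P.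

Lemma gram_eq0 m n (M : 'M[F]_(m, n)) : ctmx M *m M = 0 -> M = 0.
Proof.
move=> M0; apply: ctmx_eq0; apply/row_matrixP=> j; rewrite row0.
apply: dotmx_eq0; have -> : ctmx (row j (ctmx M)) = col j M.
  by apply/matrixP=> i k; rewrite ctmxE !mxE conjCK.
by rewrite colE mulmxA -row_mul M0 row0 mul0mx mxE.
Qed.

Lemma gram_eqmx m n (X : 'M[F]_(m, n)) : (ctmx X *m X :=: X)%MS.
Proof.
apply/eqmxP; rewrite submxMl /= submxE; apply/eqP/gram_eq0.
set K := cokermx _; have K0 : ctmx X *m X *m K = 0 by exact: mulmx_coker.
by rewrite ctmxM -mulmxA (mulmxA _ X) K0 mulmx0.
Qed.

Lemma projmx_submx m n (P : 'M[F]_n) (X : 'M[F]_(m, n)) :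
  projmx P -> (X <= P)%MS -> X *m P = X.
Proof. by case=> _ PP /submxP[D ->]; rewrite -mulmxA PP. Qed.

Lemma projmx_eq n (P Q : 'M[F]_n) :
  projmx P -> projmx Q -> (P <= Q)%MS -> (Q <= P)%MS -> P = Q.
Proof.
move=> pP pQ PQ QP; have e1 := projmx_submx pQ PQ; have e2 := projmx_submx pP QP.
by rewrite -e1 -{1}pP.1 -{1}pQ.1 -ctmxM e2 pQ.1.
Qed.

Lemma projmx_orth n (P : 'M[F]_n) : projmx P -> projmx (1%:M - P).
Proof.
move=> [hP PP]; split; first by rewrite ctmxD ctmxN ctmx1 hP.
by rewrite mulmxBr mulmx1 mulmxBl mul1mx PP subrr subr0.
Qed.

Lemma projmx_mul_orth n (P : 'M[F]_n) : projmx P -> P *m (1%:M - P) = 0.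
Proof. by case=> _ PP; rewrite mulmxBr mulmx1 PP subrr. Qed.

Lemma proj_ortho_projmx m n (U : 'M[F]_(m, n)) : projmx (proj_ortho U).
Proof.
set P := proj_ortho U; split; last exact: proj_ortho_proj.
(* The left side is self-adjoint by its shape, so this equation carries the symmetry of [P]. It
   follows from the rows of [1 - P] being orthogonal to those of [P]. *)
suff PP : P *m ctmx P = P by rewrite -{1}PP ctmxM ctmxK.
have /submxP[D eP] : (P <= U)%MS by rewrite -[P]mul1mx proj_ortho_sub.
have /orthomx1P := proj_ortho_compl_sub U (1%:M : 'M[F]_n).
rewrite mul1mx -/P -map_trmx -[(map_mx _ _)^T]/(ctmx U) => PU.
clearbody P; have : (1%:M - P) *m ctmx P = 0 by rewrite {2}eP ctmxM mulmxA PU mul0mx.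
rewrite mulmxBl mul1mx => /eqP; rewrite subr_eq0 => /eqP PP.
by have := congr1 (@ctmx _ _ _) PP; rewrite ctmxM ctmxK => <-.
Qed.

Variable n : nat.
Implicit Types P Q : 'M[F]_n.

Let meet P Q : 'M[F]_n := proj_ortho (P :&: Q)%MS.
Let join P Q : 'M[F]_n := proj_ortho (P + Q)%MS.

(** The meet lies below [P], hence is orthogonal to [1 - P], and orthogonal projectors have their
    sum as join. *)
Lemma sasaki_impE P Q : projmx P -> projmx Q ->
  join (1%:M - P) (meet P Q) = 1%:M - P + meet P Q.
Proof.
move=> pP pQ; set A := meet P Q; have pA : projmx A by exact: proj_ortho_projmx.
have pO := projmx_orth pP.
have AP : A *m P = A.
  by apply: projmx_submx; rewrite ?proj_orthoE ?capmxSl.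
have AO : A *m (1%:M - P) = 0 by rewrite mulmxBr mulmx1 AP subrr.
move: (1%:M - P) pO AO => O pO AO.
have OA : O *m A = 0 by rewrite -pA.1 -pO.1 -ctmxM AO ctmx0.
have pS : projmx (O + A).
  split; first by rewrite ctmxD pO.1 pA.1.
  by rewrite mulmxDl !mulmxDr pO.2 pA.2 AO OA add0r addr0.
apply: projmx_eq => //; first exact: proj_ortho_projmx.
  rewrite proj_orthoE addsmx_sub; apply/andP; split; apply/submxP.
    by exists O; rewrite mulmxDr pO.2 OA addr0.
  by exists A; rewrite mulmxDr pA.2 AO add0r.
by rewrite proj_orthoE addmx_sub_adds.
Qed.

Lemma mul_proj_ortho m P (U : 'M[F]_(m, n)) : projmx P -> (U <= P)%MS ->
  P *m proj_ortho U = proj_ortho U.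
Proof.
move=> pP UP; have pA := proj_ortho_projmx U.
by rewrite -{1}pA.1 -{1}pP.1 -ctmxM projmx_submx ?pA.1 // proj_orthoE.
Qed.

Lemma sasaki_impM P Q : projmx P -> projmx Q ->
  P *m join (1%:M - P) (meet P Q) = meet P Q.
Proof.
move=> pP pQ; rewrite sasaki_impE // mulmxDr projmx_mul_orth // add0r.
by rewrite mul_proj_ortho // capmxSl.
Qed.

(** With [sub_sasaki_conj]: the Sasaki conjunction is the image of [Q] under the orthogonal
    projection onto [P]. Here a vector of the meet is fixed by [P], and [P] kills its component in
    the complement of [P]. *)
Lemma sasaki_conj_sub P Q : projmx P -> projmx Q ->
  (meet P (join (1%:M - P) Q) <= Q *m P)%MS.
Proof.
move=> pP pQ; set E := meet _ _.
have EP : E *m P = E by apply: projmx_submx; rewrite ?proj_orthoE ?capmxSl.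
have : (E <= 1%:M - P + Q)%MS.
  rewrite proj_orthoE; apply: submx_trans (capmxSr _ _) _.
  by rewrite proj_orthoE.
move=> /sub_addsmxP[[a b] /= eE]; rewrite -EP eE mulmxDl -!mulmxA.
have -> : (1%:M - P) *m P = 0 by rewrite mulmxBl mul1mx pP.2 subrr.
by rewrite mulmx0 add0r submxMl.
Qed.

Lemma sub_sasaki_conj P Q : projmx P -> projmx Q ->
  (Q *m P <= meet P (join (1%:M - P) Q))%MS.
Proof.
move=> pP pQ; rewrite proj_orthoE sub_capmx submxMl proj_orthoE /=.
have -> : Q *m P = - Q *m (1%:M - P) + Q.
  by rewrite mulNmx mulmxBr mulmx1 opprB subrK.
by rewrite addmx_sub_adds ?submxMl.
Qed.

Lemma sasaki_conjM P Q : projmx P -> projmx Q ->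
  Q *m P *m meet P (join (1%:M - P) Q) = Q *m P.
Proof.
by move=> pP pQ; apply: projmx_submx; [apply: proj_ortho_projmx|apply: sub_sasaki_conj].
Qed.

Lemma sasaki_conjMr P Q : projmx P -> projmx Q ->
  meet P (join (1%:M - P) Q) *m Q = P *m Q.
Proof.
move=> pP pQ; set E := meet _ _; have pE : projmx E by exact: proj_ortho_projmx.
have EP : E *m P = E by apply: projmx_submx; rewrite ?proj_orthoE ?capmxSl.
rewrite -{1}EP -mulmxA; have := congr1 (@ctmx _ _ _) (sasaki_conjM pP pQ).
by rewrite -/E; clearbody E; rewrite !ctmxM pP.1 pQ.1 pE.1.
Qed.

End Projections.

Section PositiveMaps.
Variables (F : numClosedFieldType) (n : nat).
Implicit Types (A B rho sigma : 'M[F]_n) (E : 'M[F]_n -> 'M[F]_n).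

Definition lin E := forall a A B, E (a *: A + B) = a *: E A + E B.

Definition posmap E := lin E /\ forall rho, psdmx rho -> psdmx (E rho).

Lemma linD E A B : lin E -> E (A + B) = E A + E B.
Proof. by move=> l; have := l 1 A B; rewrite !scale1r. Qed.

Lemma lin0 E : lin E -> E 0 = 0.
Proof. by move=> l; apply: (addrI (E 0)); rewrite -(linD _ _ l) !addr0. Qed.

Lemma linZ E a A : lin E -> E (a *: A) = a *: E A.
Proof. by move=> l; have := l a A 0; rewrite (lin0 l) !addr0. Qed.

Lemma linN E A : lin E -> E (- A) = - E A.
Proof. by move=> l; rewrite -scaleN1r (linZ _ _ l) scaleN1r. Qed.

(* Each vector [u sigma] of the support satisfies
   [(u sigma)^* (u sigma) <= c sigma], and such rank-one matrices span. *)
Lemma posmap_supp E sigma tau : posmap E -> psdmx sigma -> ctmx tau = tau ->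
  (tau <= sigma)%MS -> (E tau <= E sigma)%MS.
Proof.
move=> [lE pE] ps ht ts; have hs := psdmx_adj ps.
have H A : (E (sigma *m A *m sigma) <= E sigma)%MS.
  elim/rank1_span_ind: A => [a A B HA HB|u].
    rewrite mulmxDr mulmxDl -scalemxAr -scalemxAl lE.
    by rewrite addmx_sub ?scalemx_sub.
  have -> : sigma *m (ctmx u *m u) *m sigma = ctmx (u *m sigma) *m (u *m sigma).
    by rewrite ctmxM hs !mulmxA.
  have [c c0 pc] := psdmx_rank1_dominated u ps.
  suff /submx_trans: (E (ctmx (u *m sigma) *m (u *m sigma)) <= c *: E sigma)%MS.
    by apply; apply: scalemx_sub.
  apply: psdmx_le_submx; first exact/pE/psdmx_gram.
  by rewrite -(linZ _ _ lE) -(linN _ lE) -(linD _ _ lE); apply: pE.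
(* Inclusion of row spaces factors [sigma] out on the right; as both matrices are Hermitian, it also
   factors out on the left. Hence [tau] has the form [sigma A sigma] treated by [H]. *)
have e1 : tau = tau *m pinvmx sigma *m sigma by rewrite mulmxKpV.
have e2 : tau = sigma *m (ctmx (tau *m pinvmx sigma)) by rewrite -{1}ht {1}e1 ctmxM hs.
by rewrite e1 {1}e2 -(mulmxA sigma); apply: H.
Qed.

Lemma gram_posmap_supp E m (X : 'M[F]_(m, n)) rho : posmap E ->
  psdmx rho -> (rho <= X)%MS -> (E rho <= E (ctmx X *m X))%MS.
Proof.
move=> pE pr rX; apply: posmap_supp => //; first exact: psdmx_gram.
  exact: psdmx_adj.
by rewrite gram_eqmx.
Qed.

(** Cyclicity makes the trace a combination of entries of [rho] with the entries of [M M^*] as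
    coefficients, and each entry of a positive matrix is bounded by its trace. In the witness
    [(1 + K)^-1] the [1] covers [K = 0]. *)
Lemma psdmx_trace_conj m (M : 'M[F]_(n, m)) : exists2 c : F, 0 < c &
  forall rho, psdmx rho -> c * \tr (ctmx M *m rho *m M) <= \tr rho.
Proof.
pose K := \sum_i \sum_j `|(M *m ctmx M) j i|.
have K0 : 0 <= K by do 2![apply: sumr_ge0 => ? _].
have K1 : 0 < 1 + K by rewrite ltr_wpDr.
exists (1 + K)^-1 => [|rho pr]; first by rewrite invr_gt0.
have t0 := psdmx_trace_ge0 pr.
rewrite mulrC ler_pdivrMr //.
have : \tr (ctmx M *m rho *m M) <= K * \tr rho.
  rewrite -mulmxA mxtrace_mulC -mulmxA.
  rewrite -[X in X <= _]ger0_norm; last first.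
    by rewrite mulmxA -mxtrace_mulC mulmxA psdmx_trace_ge0 //; apply: psdmx_conj.
  apply: le_trans (ler_norm_sum _ _ _) _; rewrite mulr_suml.
  apply: ler_sum => i _; rewrite mxE; apply: le_trans (ler_norm_sum _ _ _) _.
  rewrite mulr_suml; apply: ler_sum => j _; rewrite normrM mulrC.
  by rewrite ler_wpM2l // psdmx_entry.
by move/le_trans; apply; rewrite mulrDr mulr1 [_ * K]mulrC lerDr.
Qed.

End PositiveMaps.

(** * Operators and maps on a register *)

(** Selecting indices is a compression by a 0-1 matrix, even when [f] repeats indices. *)
Lemma psdmx_mxsub (F : numClosedFieldType) m n (f : 'I_m -> 'I_n) (A : 'M[F]_n) :
  psdmx A -> psdmx (mxsub f f A).
Proof.
move=> pA; pose X : 'M[F]_(n, m) := colsub f 1%:M.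
suff -> : mxsub f f A = ctmx X *m A *m X by exact: psdmx_conj.
have -> : ctmx X = rowsub f 1%:M.
  by apply/matrixP=> i j; rewrite ctmxE !mxE rmorph_nat eq_sym.
by rewrite -rowsubE /X mulmx_colsub mulmx1; apply/matrixP=> i j; rewrite !mxE.
Qed.

Section Registers.
Variables (V : finType) (W : {set V}).
Implicit Types (s t : BV V) (a b : BW W).

Definition agree_off s t := [forall x, (x \notin W) ==> (s x == t x)].

Lemma agree_offP s t :
  reflect (forall x, x \notin W -> s x = t x) (agree_off s t).
Proof.
apply: (iffP forallP) => [H x xW|H x]; first by have := H x; rewrite xW => /eqP.
by apply/implyP=> /H ->.
Qed.

Lemma agree_off_sym s t : agree_off s t = agree_off t s.
Proof. by apply: eq_forallb => x; rewrite eq_sym. Qed.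

Lemma merge_in a s (x : reg W) : Defs.merge a s (val x) = a x.
Proof. by rewrite ffunE valK. Qed.

Lemma merge_out a s x : x \notin W -> Defs.merge a s x = s x.
Proof. by move=> xW; rewrite ffunE insubN. Qed.

Lemma bv_split s t : restr W s = restr W t -> agree_off s t -> s = t.
Proof.
move=> /ffunP e /agree_offP H; apply/ffunP=> x.
have [xW|/H //] := boolP (x \in W).
by have := e (Sub x xW); rewrite !ffunE.
Qed.

Lemma restr_merge a s : restr W (Defs.merge a s) = a.
Proof. by apply/ffunP=> x; rewrite ffunE merge_in. Qed.

Lemma agree_merge a s t : agree_off (Defs.merge a s) t = agree_off s t.
Proof.
by apply: eq_forallb => x; case: (boolP (x \in W)) => //= xW; rewrite merge_out.
Qed.

Lemma agree_off_refl s : agree_off s s.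
Proof. exact/agree_offP. Qed.

Lemma eq_merge a s t : agree_off s t -> Defs.merge a s = Defs.merge a t.
Proof.
move=> st; apply: bv_split; first by rewrite !restr_merge.
by rewrite agree_merge agree_off_sym agree_merge agree_off_sym.
Qed.

Lemma merge_restr s t : agree_off s t -> Defs.merge (restr W s) t = s.
Proof.
move=> st; apply: bv_split; first by rewrite restr_merge.
by rewrite agree_merge agree_off_sym.
Qed.

Lemma mergeA a b s : Defs.merge a (Defs.merge b s) = Defs.merge a s.
Proof. by apply: eq_merge; rewrite agree_merge agree_off_refl. Qed.

Lemma gidxK s : gval (gidx s) = s. Proof. exact: enum_rankK. Qed.

Lemma gvalK (i : 'I_(gdim V)) : gidx (gval i) = i. Proof. exact: enum_valK. Qed.

Lemma lidxK a : lval (lidx a) = a. Proof. exact: enum_rankK. Qed.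

Lemma lvalK (i : 'I_(ldim W)) : lidx (lval i) = i. Proof. exact: enum_valK. Qed.

(** The zeros of an extended operator restrict matrix products to states agreeing off the register;
    this reindexing turns such a product into a sum over the local basis. *)
Lemma sum_agree (T : nmodType) t (f : 'I_(gdim V) -> T) :
  \sum_(j | agree_off (gval j) t) f j =
  \sum_(a < ldim W) f (gidx (Defs.merge (lval a) t)).
Proof.
rewrite (reindex_onto (fun a : 'I_(ldim W) => gidx (Defs.merge (lval a) t))
  (fun j => lidx (restr W (gval j)))) /=.
  apply: eq_bigl => a; rewrite gidxK agree_merge agree_off_refl restr_merge lvalK.
  by rewrite eqxx.
by move=> j jt; rewrite lidxK merge_restr // gvalK.
Qed.

(* [(s, a) |-> (merge a s, restr s)] is an involution: it swaps the register
   content of [s] with [a]. *)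
Lemma sum_swap (T : nmodType) (f : 'I_(gdim V) -> 'I_(ldim W) -> T) :
  \sum_i \sum_(a < ldim W) f (gidx (Defs.merge (lval a) (gval i))) (lidx (restr W (gval i))) =
  \sum_i \sum_a f i a.
Proof.
rewrite !pair_big /=.
rewrite [RHS](reindex_inj (h := fun p : 'I_(gdim V) * 'I_(ldim W) =>
  (gidx (Defs.merge (lval p.2) (gval p.1)), lidx (restr W (gval p.1))))) //.
apply: (can_inj (g := fun p : 'I_(gdim V) * 'I_(ldim W) =>
  (gidx (Defs.merge (lval p.2) (gval p.1)), lidx (restr W (gval p.1))))) => -[i a] /=.
by rewrite !gidxK !lidxK mergeA restr_merge merge_restr ?agree_off_refl // gvalK lvalK.
Qed.

End Registers.

Section Extension.
Variables (F : numClosedFieldType) (V : finType) (W : {set V}).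
Local Notation g := (gdim V).
Local Notation l := (ldim W).
Local Notation loc i := (lidx (restr W (gval i))).
Implicit Types (A B : 'M[F]_l) (X Y : 'M[F]_g).

Definition extmx A : 'M[F]_g :=
  \matrix_(i, j) (A (loc i) (loc j) *
    [forall x, (x \notin W) ==> (gval i x == gval j x)]%:R).

Definition blockmx X (s t : BV V) : 'M[F]_l :=
  \matrix_(a, b) X (gidx (Defs.merge (lval a) s)) (gidx (Defs.merge (lval b) t)).

Definition extmap (E : 'M[F]_l -> 'M[F]_l) : 'M[F]_g -> 'M[F]_g :=
  fun X => \matrix_(i, j) E (blockmx X (gval i) (gval j)) (loc i) (loc j).

Lemma extmxE A i j :
  extmx A i j = A (loc i) (loc j) * (agree_off W (gval i) (gval j))%:R.
Proof. by rewrite mxE. Qed.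

Lemma mul_extmxl A m (X : 'M[F]_(g, m)) i j :
  (extmx A *m X) i j = \sum_a A (loc i) a * X (gidx (Defs.merge (lval a) (gval i))) j.
Proof.
transitivity (\sum_(k | agree_off W (gval k) (gval i)) A (loc i) (loc k) * X k j).
  rewrite mxE [RHS]big_mkcond; apply: eq_bigr => k _; rewrite extmxE agree_off_sym.
  by case: ifP => _; rewrite ?mulr1 ?mulr0 ?mul0r.
by rewrite sum_agree; apply: eq_bigr => a _; rewrite gidxK restr_merge lvalK.
Qed.

Lemma mul_extmxr A m (X : 'M[F]_(m, g)) i j :
  (X *m extmx A) i j = \sum_a X i (gidx (Defs.merge (lval a) (gval j))) * A a (loc j).
Proof.
transitivity (\sum_(k | agree_off W (gval k) (gval j)) X i k * A (loc k) (loc j)).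
  rewrite mxE [RHS]big_mkcond; apply: eq_bigr => k _; rewrite extmxE.
  by case: ifP => _; rewrite ?mulr1 ?mulr0 ?mulr0.
by rewrite sum_agree; apply: eq_bigr => a _; rewrite gidxK restr_merge lvalK.
Qed.

Lemma extmxM A B : extmx (A *m B) = extmx A *m extmx B.
Proof.
apply/matrixP=> i j; rewrite mul_extmxl extmxE mxE mulr_suml.
by apply: eq_bigr => a _; rewrite extmxE gidxK restr_merge lvalK agree_merge mulrA.
Qed.

Lemma extmx1 : extmx 1%:M = 1%:M.
Proof.
apply/matrixP=> i j; rewrite extmxE !mxE -natrM mulnb; congr (_%:R); congr nat_of_bool.
apply/andP/eqP => [[/eqP e H]|->]; last by rewrite eqxx agree_off_refl.
rewrite -(gvalK i) -(gvalK j); congr gidx; apply: bv_split H.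
by rewrite -[LHS]lidxK e lidxK.
Qed.

Lemma extmxD A B : extmx (A + B) = extmx A + extmx B.
Proof. by apply/matrixP=> i j; rewrite [RHS]mxE !extmxE mxE mulrDl. Qed.

Lemma extmxN A : extmx (- A) = - extmx A.
Proof. by apply/matrixP=> i j; rewrite [RHS]mxE !extmxE mxE mulNr. Qed.

Lemma ctmx_ext A : ctmx (extmx A) = extmx (ctmx A).
Proof.
by apply/matrixP=> i j; rewrite ctmxE !extmxE ctmxE rmorphM rmorph_nat agree_off_sym.
Qed.

Lemma extmx_projmx P : projmx P -> projmx (extmx P).
Proof. by case=> hP PP; split; rewrite ?ctmx_ext ?hP // -extmxM PP. Qed.

Lemma extmx_orth P : extmx (1%:M - P) = 1%:M - extmx P.
Proof. by rewrite extmxD extmxN extmx1. Qed.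

Lemma blockmx_conj A B X s t :
  blockmx (extmx A *m X *m extmx B) s t = A *m blockmx X s t *m B.
Proof.
apply/matrixP=> a b; rewrite mxE mul_extmxr [RHS]mxE; apply: eq_bigr => b' _.
rewrite !gidxK restr_merge lvalK mergeA; congr (_ * _).
rewrite mul_extmxl mxE; apply: eq_bigr => a' _.
by rewrite !gidxK restr_merge lvalK mergeA mxE.
Qed.

Lemma eq_blockmx X s s' t t' : agree_off W s s' -> agree_off W t t' ->
  blockmx X s t = blockmx X s' t'.
Proof.
by move=> hs ht; apply/matrixP=> a b; rewrite !mxE (eq_merge _ hs) (eq_merge _ ht).
Qed.

Lemma extmap_pre A B E X :
  extmap (fun Z => E (A *m Z *m B)) X = extmap E (extmx A *m X *m extmx B).
Proof. by apply/matrixP=> i j; rewrite !mxE blockmx_conj. Qed.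

Lemma extmap_post A B E X :
  extmap (fun Z => A *m E Z *m B) X = extmx A *m extmap E X *m extmx B.
Proof.
apply/matrixP=> i j; rewrite mul_extmxr mxE mxE; apply: eq_bigr => b _.
rewrite mul_extmxl mxE; congr (_ * _); apply: eq_bigr => a _; congr (_ * _).
rewrite mxE !gidxK !restr_merge !lvalK; congr (E _ _ _).
by apply: eq_blockmx; rewrite agree_off_sym agree_merge agree_off_refl.
Qed.

Lemma extmapZ a E X : extmap (fun Z => a *: E Z) X = a *: extmap E X.
Proof. by apply/matrixP=> i j; rewrite !mxE. Qed.

Definition cpmx n (E : 'M[F]_n -> 'M[F]_n) : Prop :=
  lin E /\
  forall (k : nat) (rho : 'M[F]_(\sum_(i < k) n)), psdmx rho ->
    psdmx (\mxblock_(i < k, j < k) E (submxblock (p_ := fun _ : 'I_k => n)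
                                                (q_ := fun _ : 'I_k => n) rho i j)).

Definition tnimx n (E : 'M[F]_n -> 'M[F]_n) : Prop :=
  forall rho : 'M[F]_n, psdmx rho -> \tr (E rho) <= \tr rho.

Lemma ctmx_mxdiag n k (M : 'M[F]_n) :
  ctmx (\mxdiag_(i < k) M) = \mxdiag_(i < k) ctmx M.
Proof.
rewrite -tr_mxdiag /ctmx; congr trmx; apply/matrixP=> x y; rewrite !mxE.
by case: ifP; rewrite ?conform_mx_id !mxE ?rmorph0.
Qed.

Lemma cpmx_conj_pre n (M : 'M[F]_n) E :
  cpmx E -> cpmx (fun Z => E (ctmx M *m Z *m M)).
Proof.
move=> [lE pE]; split=> [a A B|k rho pr].
  by rewrite mulmxDr mulmxDl -scalemxAr -scalemxAl lE.
(* Conjugating each block by [M] amounts to conjugating the whole block matrix by [D]. *)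
pose D := \mxdiag_(i < k) M.
have := pE k (ctmx D *m rho *m D) (psdmx_conj D pr).
rewrite -{1}[rho]submxblockK.
rewrite ctmx_mxdiag mul_mxdiag_mxblock mul_mxblock_mxdiag.
suff -> : \mxblock_(i < k, j < k) E (ctmx M *m submxblock rho i j *m M) =
  \mxblock_(i < k, j < k) E (submxblock
    (\mxblock_(i < k, j < k) (ctmx M *m submxblock rho i j *m M)) i j) by [].
by apply: eq_mxblock => i j; rewrite mxblockK.
Qed.

Lemma cpmx_conj_post n (M : 'M[F]_n) E :
  cpmx E -> cpmx (fun Z => ctmx M *m E Z *m M).
Proof.
move=> [lE pE]; split=> [a A B|k rho pr].
  by rewrite lE mulmxDr mulmxDl -scalemxAr -scalemxAl.
pose D := \mxdiag_(i < k) M.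
have := psdmx_conj D (pE k rho pr).
by rewrite ctmx_mxdiag mul_mxdiag_mxblock mul_mxblock_mxdiag.
Qed.

Lemma cpmxZ n a (E : 'M[F]_n -> 'M[F]_n) :
  0 <= a -> cpmx E -> cpmx (fun Z => a *: E Z).
Proof.
move=> a0 [lE pE]; split=> [b A B|k rho pr].
  by rewrite lE scalerDr !scalerA mulrC.
suff -> : \mxblock_(i < k, j < k) (a *: E (submxblock rho i j)) =
  a *: \mxblock_(i < k, j < k) E (submxblock rho i j) by apply/psdmxZ/pE.
by apply/matrixP=> i j; rewrite !mxE.
Qed.

(* Indexing the blocks by all global basis states (with repetitions) exhibits
   both the argument and the value of [extmap E] as compressions of block matrices. *)
Lemma extmap_posmap E : cpmx E -> posmap (extmap E).
Proof.
move=> [lE pE]; split=> [a X Y|X pX].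
  apply/matrixP=> i j; rewrite !mxE.
  have -> : blockmx (a *: X + Y) (gval i) (gval j) =
    a *: blockmx X (gval i) (gval j) + blockmx Y (gval i) (gval j).
    by apply/matrixP=> x y; rewrite !mxE.
  by rewrite lE !mxE.
pose f (x : 'I_(\sum_(i < g) l)) : 'I_g :=
  gidx (Defs.merge (lval (tagnat.sig2 x)) (gval (tagnat.sig1 x))).
have pB := psdmx_mxsub (fun i : 'I_g => tagnat.Rank i (loc i) : 'I_(\sum_(i < g) l))
  (pE g _ (psdmx_mxsub f pX)).
suff -> : extmap E X = mxsub (fun i : 'I_g => tagnat.Rank i (loc i))
   (fun i : 'I_g => tagnat.Rank i (loc i)) (\mxblock_(i < g, j < g)
     E (submxblock (p_ := fun _ : 'I_g => l) (q_ := fun _ : 'I_g => l)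
        (mxsub f f X) i j)) by [].
set B := \mxblock_(i, j) _; apply/matrixP=> i j.
transitivity (submxblock (p_ := fun _ : 'I_g => l) (q_ := fun _ : 'I_g => l)
  B i j (loc i) (loc j)); last by rewrite !mxE.
rewrite mxblockK mxE; congr (E _ _ _); apply/matrixP=> a b.
have fE k c : f (tagnat.Rank k c) = gidx (Defs.merge (lval c) (gval k)).
  rewrite /f tagnat.Rank1K; congr (gidx (Defs.merge (lval _) _)).
  by apply: val_inj; rewrite tagnat.Rank2K.
by rewrite [RHS]mxE [RHS]mxE !fE mxE.
Qed.

(** Multiplied by [l], both traces become sums over pairs of a state and a register content. After
    [sum_swap] each inner sum is the trace of a diagonal block, where the bound on [E] applies. The
    all-false assignment shows [l > 0]. *)
Lemma extmap_tni E : tnimx E -> tnimx (extmap E).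
Proof.
move=> tE X pX.
have l0 : 0 < l%:R :> F.
  by rewrite ltr0n; apply/card_gt0P; exists [ffun _ => false].
rewrite -(ler_pM2r l0).
have H (f : 'I_g -> F) : (\sum_i f i) * l%:R = \sum_i \sum_(a < l) f i.
  by rewrite mulr_suml; apply: eq_bigr => i _; rewrite sumr_const card_ord mulr_natr.
rewrite /mxtrace !H.
rewrite -(sum_swap (W := W) (fun i _ => extmap E X i i)) -(sum_swap (W := W) (fun i _ => X i i)).
apply: ler_sum => i _.
have -> : \sum_(a < l) extmap E X (gidx (Defs.merge (lval a) (gval i))) (gidx (Defs.merge (lval a) (gval i)))
   = \tr (E (blockmx X (gval i) (gval i))).
  apply: eq_bigr => a _; rewrite mxE gidxK restr_merge lvalK.
  by rewrite (eq_blockmx X (s' := gval i) (t' := gval i)) // agree_merge agree_off_refl.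
have -> : \sum_(a < l) X (gidx (Defs.merge (lval a) (gval i))) (gidx (Defs.merge (lval a) (gval i)))
   = \tr (blockmx X (gval i) (gval i)) by apply: eq_bigr => a _; rewrite mxE.
apply: tE; rewrite (_ : blockmx _ _ _ =
  mxsub (fun a : 'I_l => gidx (Defs.merge (lval a) (gval i)))
        (fun a : 'I_l => gidx (Defs.merge (lval a) (gval i))) X); first exact: psdmx_mxsub.
by apply/matrixP=> a b; rewrite !mxE.
Qed.

End Extension.

(** * Specification statements *)

Section Specifications.
Variables (F : numClosedFieldType) (n : nat).
Implicit Types (E : 'M[F]_n -> 'M[F]_n) (P Q R M : 'M[F]_n).

Definition specmx Q R E : Prop :=
  [/\ cpmx E, tnimx E & forall rho, psdmx rho /\ \tr rho <= 1 ->
      (rho <= Q)%MS -> (E rho <= R)%MS].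

(** The case of a single block. Its index type ['I_(\sum_(i < 1) n)] is not literally ['I_n], so
    matrices are reindexed in both directions. *)
Lemma cpmx_posmap E : cpmx E -> posmap E.
Proof.
move=> [lE pE]; split=> // rho pr.
have := pE 1%N _ (psdmx_mxsub (fun x : 'I_(\sum_(i < 1) n) => tagnat.sig2 x) pr).
move=> /(psdmx_mxsub (fun a => tagnat.Rank 0 a : 'I_(\sum_(i < 1) n))).
rewrite -[mxsub _ _ (\mxblock_(i, j) _)]/(submxblock (p_ := fun=> n) (q_ := fun=> n) _ 0 0).
rewrite mxblockK; congr (psdmx (E _)); apply/matrixP=> i j; rewrite !mxE.
by congr (rho _ _); apply: val_inj; rewrite tagnat.Rank2K.
Qed.

(** The factor [c] restores the trace bound lost by conjugating with a non-contractive [M]; since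
    [c != 0], supports do not see it. *)
Lemma specmx_pre Q Q' R M E : (Q *m M <= Q')%MS -> specmx Q' R E ->
  exists2 c : F, c != 0 & specmx Q R (fun Z => c *: E (ctmx M *m Z *m M)).
Proof.
move=> QM [cE tE sE]; have [c c0 cM] := psdmx_trace_conj M.
exists c; first by rewrite gt_eqF.
have eE rho : c *: E (ctmx M *m rho *m M) = E (c *: (ctmx M *m rho *m M)).
  by rewrite (linZ _ _ cE.1).
have pM rho : psdmx rho -> psdmx (c *: (ctmx M *m rho *m M)).
  by move=> pr; apply/psdmxZ/psdmx_conj => //; apply: ltW.
have tM rho : psdmx rho -> \tr (c *: (ctmx M *m rho *m M)) <= \tr rho.
  by move=> pr; rewrite mxtraceZ cM.
split=> [|rho pr|rho [pr tr] rQ].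
- by apply/cpmxZ/cpmx_conj_pre => //; apply: ltW.
- by rewrite eE; apply: le_trans (tE _ (pM _ pr)) (tM _ pr).
rewrite eE; apply: sE; first by split; [apply: pM | apply: le_trans (tM _ pr) tr].
by rewrite scalemx_sub // -mulmxA mulmx_sub // (submx_trans _ QM) // submxMr.
Qed.

Lemma specmx_post Q R R' M E : (R' *m M <= R)%MS -> specmx Q R' E ->
  exists2 c : F, c != 0 & specmx Q R (fun Z => c *: (ctmx M *m E Z *m M)).
Proof.
move=> RM [cE tE sE]; have [c c0 cM] := psdmx_trace_conj M.
exists c; first by rewrite gt_eqF.
have pE := (cpmx_posmap cE).2.
split=> [|rho pr|rho [pr tr] rQ].
- by apply/cpmxZ/cpmx_conj_post => //; apply: ltW.
- by rewrite mxtraceZ; apply: le_trans (cM _ (pE _ pr)) (tE _ pr).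
rewrite scalemx_sub // -mulmxA mulmx_sub // (submx_trans _ RM) // submxMr //.
exact: sE.
Qed.

(* [M] is the identity on [P] and kills a complement of [P :&: Q] in [Q]. *)
Lemma oblique_proj P Q :
  exists M, P *m M = P /\ (Q *m M <= P :&: Q)%MS.
Proof.
have PQ0 : (P :&: (Q :\: P) = 0)%MS by rewrite capmxC capmx_diff.
exists (proj_mx P (Q :\: P)%MS); split; first by rewrite proj_mx_id.
have : (Q <= (Q :&: P) + (Q :\: P))%MS by rewrite addsmxC addsmx_diff_cap_eq.
move=> /sub_addsmxP[[a b] /= eQ]; rewrite {1}eQ mulmxDl -!mulmxA.
rewrite [(Q :\: P)%MS *m _]proj_mx_0 // mulmx0 addr0 proj_mx_id ?capmxSr //.
by rewrite capmxC submxMl.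
Qed.

(* [M] lifts each vector of [R P] back to a preimage in [R] under the projection [P]. *)
Lemma oblique_lift P R : projmx P ->
  exists M, M *m P = P /\ (R *m P *m M <= R)%MS.
Proof.
move=> pP; have := mulmxKpV (submx_refl (R *m P)).
move: (pinvmx _) => K hK; exists (1%:M + K *m R *m (1%:M - P)).
have OP : (1%:M - P) *m P = 0 by rewrite mulmxBl mul1mx pP.2 subrr.
split; first by rewrite mulmxDl mul1mx -(mulmxA (K *m R)) OP mulmx0 addr0.
have -> : R *m P *m (1%:M + K *m R *m (1%:M - P)) = R *m P *m K *m R.
  rewrite mulmxDr mulmx1 !mulmxA mulmxBr mulmx1 -[_ *m R *m P]mulmxA hK.
  by rewrite addrC subrK.
exact: submxMl.
Qed.

End Specifications.

(** * Largest subspaces and preimages *)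

Section Suprema.
Variables (F : fieldType) (n : nat).

(** If some member is not below [Z], adding it strictly increases the rank, which is at most [n]; so
    the enlargement stops. This replaces infinite joins. *)
Lemma submx_sup_exists (Pr : 'M[F]_n -> Prop) :
  (forall X, (X <= (0 : 'M[F]_n))%MS -> Pr X) ->
  (forall X Y, Pr X -> Pr Y -> Pr (X + Y)%MS) ->
  exists2 Z, Pr Z & forall X, Pr X -> (X <= Z)%MS.
Proof.
move=> P0 PD; have {P0} : Pr 0 by exact: P0.
move: {1}(0 : 'M[F]_n) => Z.
have [k] := ubnP (n - \rank Z); elim: k Z => // k IH Z ltk PZ.
case: (Classical_Prop.classic (forall X, Pr X -> (X <= Z)%MS)) => [H|H].
  by exists Z.
have [X H'] := Classical_Pred_Type.not_all_ex_not _ _ H.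
have [PX /negP XZ] := Classical_Prop.imply_to_and _ _ H'.
apply: (IH (Z + X)%MS); last exact: PD.
have ltZ : (\rank Z < \rank (Z + X)%MS)%N.
  have := mxrank_leqif_sup (addsmxSl Z X); case=> le1 eq1.
  rewrite ltn_neqAle le1 andbT eq1 addsmx_sub submx_refl /=.
  exact/negP.
have := rank_leq_col (Z + X)%MS; move: ltk ltZ; rewrite !ltnS.
move: (\rank Z) (\rank (Z + X)%MS) => a b h1 h2 h3.
by apply: leq_trans h1; rewrite ltn_sub2l // (leq_trans h2).
Qed.

(** Right adjoint of multiplication by [M], the analogue of a weakest precondition for one matrix
    factor. *)
Lemma submx_preim m (M Y : 'M[F]_n) : exists Z : 'M[F]_n,
  forall X : 'M[F]_(m, n), (X *m M <= Y)%MS = (X <= Z)%MS.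
Proof.
exists (kermx (M *m cokermx Y)) => X.
by rewrite sub_kermx mulmxA submxE.
Qed.

End Suprema.

(** * Sets of positive maps acting on subspaces *)

Section Transformers.
Variables (F : numClosedFieldType) (n : nat).
Implicit Types (X Y L M : 'M[F]_n) (E : 'M[F]_n -> 'M[F]_n).

Lemma posmap_conj M : posmap (fun X => ctmx M *m X *m M).
Proof.
split=> [a A B|rho]; last exact: psdmx_conj.
by rewrite mulmxDr mulmxDl -scalemxAr -scalemxAl.
Qed.

Lemma posmap_comp E1 E2 : posmap E1 -> posmap E2 -> posmap (E1 \o E2).
Proof.
move=> [l1 p1] [l2 p2]; split=> [a A B|rho pr]; first by rewrite /= l2 l1.
exact/p1/p2.
Qed.

Lemma posmapD E1 E2 : posmap E1 -> posmap E2 -> posmap (fun X => E1 X + E2 X).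
Proof.
move=> [l1 p1] [l2 p2]; split=> [a A B|rho pr]; last by apply: psdmxD; auto.
by rewrite l1 l2 scalerDr addrACA.
Qed.

Lemma posmap_sum k (E : 'I_k -> 'M[F]_n -> 'M[F]_n) :
  (forall i, posmap (E i)) -> posmap (fun X => \sum_i E i X).
Proof.
move=> pE; split=> [a A B|rho pr]; last by apply: psdmx_sum => i; apply: (pE i).2.
by rewrite scaler_sumr -big_split; apply: eq_bigr => i _; rewrite (pE i).1.
Qed.

Lemma posmapZ a E : 0 <= a -> posmap E -> posmap (fun X => a *: E X).
Proof.
move=> a0 [l p]; split=> [b A B|rho pr]; last by apply/psdmxZ/p.
by rewrite l scalerDr !scalerA mulrC.
Qed.

(** Lets row spaces follow the one-sided product [L M] although denotations conjugate on both sides: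
    [L] and [L L] have comparable supports, and [M^* L L M] is the Gram matrix of [L M]. *)
Lemma psdmx_mul_submx L M : psdmx L -> (L *m M <= ctmx M *m L *m M)%MS.
Proof.
move=> pL; have hL := psdmx_adj pL; rewrite -(gram_eqmx (L *m M)).
have -> : ctmx (L *m M) *m (L *m M) = ctmx M *m (L *m L) *m M.
  by rewrite ctmxM hL !mulmxA.
apply: (posmap_supp (posmap_conj M)) => //; first by rewrite ctmxM hL.
exact: submxMl.
Qed.

Lemma projmx_trace P L : projmx P ->
  \tr (P *m L *m P) + \tr ((1%:M - P) *m L *m (1%:M - P)) = \tr L.
Proof.
move=> pP; rewrite -!(mxtrace_mulC _ (_ *m L)) !mulmxA pP.2 (projmx_orth pP).2.
by rewrite -mxtraceD -mulmxDl addrC subrK mul1mx.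
Qed.

Variable D : ('M[F]_n -> 'M[F]_n) -> Prop.
Hypothesis posD : forall E, D E -> posmap E.

(* [E (X^* X)] has the largest support among the [E rho] with [rho] supported in [X]. *)
Definition maps_into X Y := forall E, D E -> (E (ctmx X *m X) <= Y)%MS.

Lemma maps_into_le X X' Y Y' : (X' <= X)%MS -> (Y <= Y')%MS ->
  maps_into X Y -> maps_into X' Y'.
Proof.
move=> XX YY H E DE; apply: submx_trans YY; apply: submx_trans (H E DE).
apply: gram_posmap_supp; [exact: posD | exact: psdmx_gram |].
by rewrite gram_eqmx.
Qed.

Lemma maps_into_adds X X' Y :
  maps_into X Y -> maps_into X' Y -> maps_into (X + X')%MS Y.
Proof.
move=> H H' E DE; have [lE pE] := posD DE.
have [psX psX'] := (psdmx_gram X, psdmx_gram X').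
suff /submx_trans: (E (ctmx (X + X')%MS *m (X + X')%MS) <=
    E (ctmx X *m X + ctmx X' *m X')%R)%MS.
  by apply; rewrite (linD _ _ lE) addmx_sub ?H ?H'.
(* Stacking [X] over [X'] spans the sum of the two subspaces, and the Gram matrix of the stack is
   the matrix sum of the two Gram matrices. *)
have := gram_posmap_supp (X := col_mx X X') (posD DE) (psdmx_gram (X + X')%MS).
have -> : ctmx (col_mx X X') *m col_mx X X' = ctmx X *m X + ctmx X' *m X'.
  by rewrite /ctmx map_col_mx tr_col_mx mul_row_col.
by apply; rewrite gram_eqmx addsmxE.
Qed.

Lemma wp_exists Y : exists Z : 'M[F]_n, forall X, maps_into X Y <-> (X <= Z)%MS.
Proof.
have [||Z HZ maxZ] := @submx_sup_exists _ _ (maps_into^~ Y).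
- move=> X; rewrite submx0 => /eqP -> E DE.
  by rewrite mulmx0 (lin0 (posD DE).1) sub0mx.
- by move=> X X'; apply: maps_into_adds.
exists Z => X; split; first exact: maxZ.
by move=> XZ; apply: maps_into_le HZ.
Qed.

(** Built from below, as the largest common lower bound of all valid [Y]. It is itself valid because
    each [E (X^* X)] is such a lower bound. *)
Lemma sp_exists X : exists Z : 'M[F]_n, forall Y, maps_into X Y <-> (Z <= Y)%MS.
Proof.
have [||Z HZ maxZ] := @submx_sup_exists _ _
  (fun Z => forall Y, maps_into X Y -> (Z <= Y)%MS).
- by move=> Z; rewrite submx0 => /eqP -> Y _; rewrite sub0mx.
- by move=> Z Z' HZ HZ' Y HY; rewrite addsmx_sub HZ ?HZ'.
exists Z => Y; split; first exact: HZ.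
by move=> ZY E DE; apply: submx_trans ZY; apply: maxZ => Y'; apply.
Qed.

End Transformers.

(** * Limits of matrices *)

Section Convergence.
Local Notation Un_cv := Rseries.Un_cv.

Definition cvgC (z : nat -> C) (l : C) : Prop :=
  Un_cv (fun N => complex.Re (z N)) (complex.Re l) /\
  Un_cv (fun N => complex.Im (z N)) (complex.Im l).

Lemma Un_cv_eq (u v : nat -> Rl) l : u =1 v -> Un_cv u l -> Un_cv v l.
Proof.
by move=> uv cu e e0; have [N HN] := cu e e0; exists N => n nN; rewrite -uv; apply: HN.
Qed.

Lemma Un_cv_cst (a : Rl) : Un_cv (fun=> a) a.
Proof.
by move=> e e0; exists 0%N => n _; rewrite Rfunctions.Rdist_eq.
Qed.

Lemma cvgC_eq u v l : u =1 v -> cvgC u l -> cvgC v l.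
Proof.
by move=> uv [c1 c2]; split; [apply: Un_cv_eq c1|apply: Un_cv_eq c2] => n; rewrite uv.
Qed.

Lemma cvgC_cst a : cvgC (fun=> a) a.
Proof. by split; apply: Un_cv_cst. Qed.

Lemma ReD (x y : C) : complex.Re (x + y) = complex.Re x + complex.Re y.
Proof. by case: x y => ? ? []. Qed.

Lemma ImD (x y : C) : complex.Im (x + y) = complex.Im x + complex.Im y.
Proof. by case: x y => ? ? []. Qed.

Lemma ReM (x y : C) : complex.Re (x * y) =
  complex.Re x * complex.Re y + - complex.Im x * complex.Im y.
Proof. by rewrite mulNr; case: x y => ? ? []. Qed.

Lemma ImM (x y : C) : complex.Im (x * y) =
  complex.Re x * complex.Im y + complex.Im x * complex.Re y.
Proof. by case: x y => ? ? []. Qed.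

Lemma ReB (x y : C) : complex.Re (x - y) = complex.Re x - complex.Re y.
Proof. by case: x y => ? ? []. Qed.

Lemma ImB (x y : C) : complex.Im (x - y) = complex.Im x - complex.Im y.
Proof. by case: x y => ? ? []. Qed.

Lemma cvgCD u v a b : cvgC u a -> cvgC v b -> cvgC (fun N => u N + v N) (a + b).
Proof.
move=> [u1 u2] [v1 v2]; split; rewrite ?ReD ?ImD.
  by apply: Un_cv_eq (SeqProp.CV_plus _ _ _ _ u1 v1) => N; rewrite ReD.
by apply: Un_cv_eq (SeqProp.CV_plus _ _ _ _ u2 v2) => N; rewrite ImD.
Qed.

Lemma cvgCM c u a : cvgC u a -> cvgC (fun N => c * u N) (c * a).
Proof.
move=> [u1 u2]; have H k := Un_cv_cst k; split; rewrite ?ReM ?ImM.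
  have := SeqProp.CV_plus _ _ _ _ (SeqProp.CV_mult _ _ _ _ (H (complex.Re c)) u1)
    (SeqProp.CV_mult _ _ _ _ (H (- complex.Im c)) u2).
  by apply: Un_cv_eq => N; rewrite ReM.
have := SeqProp.CV_plus _ _ _ _ (SeqProp.CV_mult _ _ _ _ (H (complex.Re c)) u2)
  (SeqProp.CV_mult _ _ _ _ (H (complex.Im c)) u1).
by apply: Un_cv_eq => N; rewrite ImM.
Qed.

Lemma cvgC_sum (I : Type) (r : seq I) (u : I -> nat -> C) (a : I -> C) :
  (forall i, cvgC (u i) (a i)) ->
  cvgC (fun N => \sum_(i <- r) u i N) (\sum_(i <- r) a i).
Proof.
move=> cu; elim: r => [|i r IH].
  by rewrite big_nil; apply: cvgC_eq (cvgC_cst 0) => N; rewrite big_nil.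
by rewrite big_cons; apply: cvgC_eq (cvgCD (cu i) IH) => N; rewrite big_cons.
Qed.

Lemma cvgC_unique u a b : cvgC u a -> cvgC u b -> a = b.
Proof.
case: a b => [a1 a2] [b1 b2] [/= u1 u2] [/= v1 v2].
by rewrite (SeqProp.UL_sequence _ _ _ u1 v1) (SeqProp.UL_sequence _ _ _ u2 v2).
Qed.

(** The threshold [N0] is there because a given term of a loop is dominated only by the partial sums
    long enough to contain it. *)
Lemma Un_cv_ge0 (u : nat -> Rl) (l : Rl) (N0 : nat) : (forall N, (N0 <= N)%N -> 0 <= u N) ->
  Un_cv u l -> 0 <= l.
Proof.
move=> u0 cu; rewrite leNgt; apply/negP => l0.
have [N HN] : exists N, forall n, (n >= N)%coq_nat -> Rdefinitions.Rlt (Rfunctions.Rdist (u n) l) (- l).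
  by apply: cu; apply/RltP; rewrite oppr_gt0.
have /RltP := HN (maxn N N0) (elimT ssrnat.leP (leq_maxl N N0)).
rewrite RdistE => /(le_lt_trans (ler_norm _)).
rewrite ltrBlDr addNr => /lt_le_trans /(_ (u0 _ (leq_maxr N N0))).
by rewrite ltxx.
Qed.

Lemma cvgC_ge0 u a (N0 : nat) : (forall N, (N0 <= N)%N -> 0 <= u N) -> cvgC u a -> 0 <= a.
Proof.
move=> u0 [u1 u2]; rewrite lecE /=; apply/andP; split.
  have i0 N : (N0 <= N)%N -> complex.Im (u N) = 0.
    by move=> /u0; rewrite lecE => /andP[/eqP].
  rewrite eq_le -oppr_ge0; apply/andP; split; last first.
    by apply: (@Un_cv_ge0 _ _ N0 _ u2) => N /i0 ->.
  by apply: (@Un_cv_ge0 _ _ N0 _ (SeqProp.CV_opp _ _ u2)) => N /i0; rewrite /SeqProp.opp_seq => ->; rewrite RoppE oppr0.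
by apply: Un_cv_ge0 u1 => N NN; have := u0 N NN; rewrite lecE => /andP[_]; exact.
Qed.

Section Monotone.
Variables (F : numClosedFieldType) (n : nat).

Lemma psdmx_traceB (A B : 'M[F]_n) : psdmx (A - B) -> \tr B <= \tr A.
Proof. by move=> /psdmx_trace_ge0; rewrite raddfB subr_ge0. Qed.

Lemma psdmx_entryB (A B : 'M[F]_n) i j : psdmx (A - B) ->
  `|A i j - B i j| <= \tr A - \tr B.
Proof. by move=> /(psdmx_entry i j); rewrite raddfB !mxE. Qed.

Lemma psdmx_mono (u : nat -> 'M[F]_n) : (forall N, psdmx (u N.+1 - u N)) ->
  forall N k, psdmx (u (N + k)%N - u N).
Proof.
move=> du N; elim=> [|k IH]; first by rewrite addn0 subrr; apply: psdmx0.
by rewrite addnS -(subrKA (u (N + k)%N)); apply: psdmxD.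
Qed.

End Monotone.

(* The differences [u M - u N] are positive, so their entries are dominated by their trace. *)
Lemma psdmx_monotone_cvg n (u : nat -> 'M[C]_n) (t : C) :
  (forall N, psdmx (u N.+1 - u N)) -> (forall N, \tr (u N) <= t) ->
  forall i j, exists l, cvgC (fun N => u N i j) l.
Proof.
move=> du bu i j; pose r N := complex.Re (\tr (u N)).
have psdB N k : psdmx (u (N + k)%N - u N).
  exact: psdmx_mono.
have dom N k : `|u (N + k)%N i j - u N i j| <= \tr (u (N + k)%N) - \tr (u N).
  exact: psdmx_entryB.
have cr : exists l, Un_cv r l.
  apply: Rseries.Un_cv_crit.
    by move=> N; apply/RleP; have := psdmx_traceB (du N); rewrite lecE => /andP[].
  by exists (complex.Re t) => _ [N ->]; apply/RleP; have := bu N; rewrite lecE => /andP[].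
(* [p] stands for the real or the imaginary part; the Cauchy property is inherited from the bounded
   increasing sequence of traces [r]. *)
have cauchy (p : C -> Rl) : (forall x y, p (x - y) = p x - p y) ->
    (forall x, (`|p x|%:C)%C <= `|x|) -> exists l, Un_cv (fun N => p (u N i j)) l.
  move=> pB pn; suff cc : Rseries.Cauchy_crit (fun N => p (u N i j)).
    by have [l Hl] := Rcomplete.R_complete _ cc; exists l.
  have [l0 Hl0] := cr; have cr' := SeqProp.CV_Cauchy _ (exist _ l0 Hl0).
  move=> e e0; have [N HN] := cr' e e0; exists N.
  have H a k : (a >= N)%coq_nat ->
      Rdefinitions.Rlt (Rfunctions.Rdist (p (u (a + k)%N i j)) (p (u a i j))) e.
    move=> aN; have akN : (a + k >= N)%coq_nat.
      by apply/ssrnat.leP; move/ssrnat.leP: aN => aN; rewrite (leq_trans aN) ?leq_addr.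
    apply/RltP; have /RltP := HN _ _ akN aN; rewrite !RdistE.
    apply: le_lt_trans; rewrite -pB; apply: le_trans (ler_norm _).
    have := le_trans (pn _) (dom a k); rewrite lecE => /andP[_] /=.
    by rewrite /r ReB.
  move=> a b aN bN; case: (leqP b a) => ab.
    by rewrite -(subnKC ab); apply: H.
  by rewrite Rfunctions.Rdist_sym -(subnKC (ltnW ab)); apply: H.
have [l1 H1] := cauchy _ ReB (@normc_ge_Re _).
have [|l2 H2] := cauchy _ ImB.
  (* The imaginary part of [x] is, up to sign, the real part of [x * 'i], which has the same norm as
     [x]. *)
  move=> x; have := normc_ge_Re (x * 'i%C); rewrite ReiNIm normrN => /le_trans; apply.
  by rewrite normrM complexiE normCi mulr1.
by exists (Complex l1 l2); split.
Qed.

End Convergence.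

(** * Positive trace-nonincreasing maps *)

Section Contractions.
Variable F : numClosedFieldType.

Definition contraction n (E : 'M[F]_n -> 'M[F]_n) : Prop := posmap E /\ tnimx E.

Section Square.
Variable n : nat.
Implicit Types (P L M : 'M[F]_n) (E : 'M[F]_n -> 'M[F]_n).

Lemma contraction_id : contraction (id : 'M[F]_n -> 'M[F]_n).
Proof. by split; [split | move=> rho]. Qed.

Lemma contraction0 : contraction (fun=> 0 : 'M[F]_n).
Proof.
split=> [|rho pr]; last by rewrite mxtrace0 psdmx_trace_ge0.
by split=> [a A B|rho _]; [rewrite scaler0 addr0 | apply: psdmx0].
Qed.

Lemma contraction_comp E1 E2 :
  contraction E1 -> contraction E2 -> contraction (E1 \o E2).
Proof.
move=> [p1 t1] [p2 t2]; split=> [|rho pr]; first exact: posmap_comp.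
by apply: le_trans (t1 _ (p2.2 _ pr)) (t2 _ pr).
Qed.

Lemma contraction_conj M : M *m ctmx M = 1%:M ->
  contraction (fun X => ctmx M *m X *m M).
Proof.
move=> M1; split=> [|rho pr]; first exact: posmap_conj.
by rewrite mxtrace_mulC mulmxA M1 mul1mx.
Qed.

Lemma posmap_proj P : projmx P -> posmap (fun X => P *m X *m P).
Proof. by case=> hP _; have := posmap_conj P; rewrite hP. Qed.

Lemma contraction_branch P E1 E0 : projmx P -> contraction E1 -> contraction E0 ->
  contraction (fun X => E1 (P *m X *m P) + E0 ((1%:M - P) *m X *m (1%:M - P))).
Proof.
move=> pP [p1 t1] [p0 t0].
have [c1 c0] := (posmap_proj pP, posmap_proj (projmx_orth pP)).
split=> [|rho pr]; first exact: (posmapD (posmap_comp p1 c1) (posmap_comp p0 c0)).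
by rewrite mxtraceD -(projmx_trace rho pP) lerD ?t1 ?t0 //; [apply: c1.2|apply: c0.2].
Qed.

Lemma contraction_proj P : projmx P -> contraction (fun X => P *m X *m P).
Proof.
move=> pP; have := contraction_branch pP contraction_id contraction0.
by move=> [[l p] t]; split; [exact: posmap_proj | move=> rho pr; have := t _ pr; rewrite addr0].
Qed.

Lemma contraction_mix (a : F) E1 E0 : 0 <= a <= 1 ->
  contraction E1 -> contraction E0 ->
  contraction (fun X => a *: E1 X + (1 - a) *: E0 X).
Proof.
move=> /andP[a0 a1] [p1 t1] [p0 t0]; have b0 : 0 <= 1 - a by rewrite subr_ge0.
split=> [|rho pr]; first exact: (posmapD (posmapZ a0 p1) (posmapZ b0 p0)).
have -> : \tr rho = a * \tr rho + (1 - a) * \tr rho by rewrite -mulrDl addrC subrK mul1r.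
by rewrite mxtraceD !mxtraceZ lerD // ler_wpM2l // ?t1 ?t0.
Qed.

Lemma eq_contraction E E' : E =1 E' -> contraction E -> contraction E'.
Proof.
move=> EE [[l p] t]; split=> [|rho pr]; last by rewrite -EE t.
by split=> [a A B|rho pr]; rewrite -!EE ?l //; apply: p.
Qed.

Lemma tni_branch P E L : projmx P -> tnimx E -> psdmx L ->
  \tr ((1%:M - P) *m L *m (1%:M - P)) + \tr (E (P *m L *m P)) <= \tr L.
Proof.
move=> pP tE pL; rewrite -(projmx_trace L pP) addrC lerD2r tE //.
exact: (posmap_proj pP).2.
Qed.

End Square.

Variables (V : finType) (W : {set V}).

Lemma contraction_init (z : 'I_(ldim W)) : contraction (fun rho : 'M[F]_(gdim V) =>
  \sum_(k < ldim W) extmx (delta_mx z k) *m rho *m ctmx (extmx (delta_mx z k))).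
Proof.
split=> [|rho pr].
  apply: posmap_sum => k; have := posmap_conj (ctmx (extmx (delta_mx z k) : 'M[F]_(gdim V))).
  by rewrite ctmxK.
rewrite raddf_sum /=; under eq_bigr do rewrite mxtrace_mulC mulmxA.
rewrite -raddf_sum -mulmx_suml /=.
(* Completeness relation of the Kraus operators of initialization. *)
have -> : \sum_(k < ldim W) ctmx (extmx (delta_mx z k)) *m extmx (delta_mx z k) =
    1%:M :> 'M[F]_(gdim V).
  transitivity (extmx (\sum_(k < ldim W) delta_mx k k : 'M[F]_(ldim W))).
    have -> : \sum_(k < ldim W) delta_mx k k = \sum_(k < ldim W)
        ctmx (delta_mx z k) *m delta_mx z k :> 'M[F]_(ldim W).
      apply: eq_bigr => k _; have -> : ctmx (delta_mx z k) = delta_mx k z :> 'M[F]_(ldim W).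
        by apply/matrixP=> i j; rewrite ctmxE !mxE rmorph_nat andbC.
      by rewrite mul_delta_mx.
    elim/big_rec2: _ => [|k A B _ ->].
      by apply/matrixP=> i j; rewrite extmxE !mxE mul0r.
    by rewrite extmxD extmxM ctmx_ext.
  rewrite -[RHS](@extmx1 _ _ W); congr extmx; apply/matrixP=> i j.
  rewrite summxE mxE (bigD1 i) //= mxE eqxx /= big1 ?addr0 1?eq_sym // => k ki.
  by rewrite mxE eq_sym (negbTE ki).
by rewrite mul1mx.
Qed.

Lemma contraction_unitary (U : 'M[F]_(ldim W)) : U \is unitarymx ->
  contraction (fun rho : 'M[F]_(gdim V) => extmx U *m rho *m ctmx (extmx U)).
Proof.
move=> uU; have := @contraction_conj _ (ctmx (extmx U : 'M[F]_(gdim V))).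
rewrite ctmxK; apply; rewrite ctmx_ext -extmxM.
have -> : ctmx U *m U = 1%:M; last exact: extmx1.
apply: mulmx1C; have /unitarymxP := uU; rewrite -map_trmx.
by [].
Qed.

Lemma contraction_extmap (E : 'M[F]_(ldim W) -> 'M[F]_(ldim W)) :
  cpmx E -> tnimx E -> contraction (extmap E : 'M[F]_(gdim V) -> 'M[F]_(gdim V)).
Proof. by move=> cE tE; split; [apply: extmap_posmap | apply: extmap_tni]. Qed.

Lemma specmx0 n (Q R : 'M[F]_n) : specmx Q R (fun=> 0).
Proof.
split=> [|rho pr|rho _ _]; last exact: sub0mx.
  split=> [a A B|k rho pr]; first by rewrite scaler0 addr0.
  by rewrite mxblock0; apply: psdmx0.
by rewrite mxtrace0 psdmx_trace_ge0.
Qed.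

Lemma mulmx3E m n p q (A : 'M[F]_(m, n)) (B : 'M[F]_(n, p)) (D : 'M[F]_(p, q)) i j :
  (A *m B *m D) i j = \sum_k D k j * \sum_l A i l * B l k.
Proof. by rewrite mxE; apply: eq_bigr => k _; rewrite mxE mulrC. Qed.

(** Expresses the inclusion by finitely many linear equations, which pass to limits. The factor
    [1%:M] gives them the two-sided shape of [mx_cvg_mul]. *)
Lemma submx_mulP n (A Y : 'M[F]_n) :
  (A <= Y)%MS <-> forall i j, (1%:M *m A *m cokermx Y) i j = 0.
Proof.
rewrite submxE mul1mx; split=> [/eqP -> i j|H]; first by rewrite mxE.
by apply/eqP/matrixP=> i j; rewrite H mxE.
Qed.

Lemma contraction_of n (E : 'M[F]_n -> 'M[F]_n) : lin E ->
  (forall rho, psdmx rho -> psdmx (E rho) /\ \tr (E rho) <= \tr rho) -> contraction E.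
Proof. by move=> lE H; split; [split=> // rho /H[]|move=> rho /H[]]. Qed.

End Contractions.

Lemma sum_subr_term (T : zmodType) N (f : nat -> T) (k : nat) : (k < N)%N ->
  \sum_(i < N) f i - f k = \sum_(i < N | (i : nat) != k) f i.
Proof. by move=> kN; rewrite (bigD1 (Ordinal kN)) //= addrAC subrr add0r. Qed.

(** * Limits of loop denotations *)

Section Loops.
Variable V : finType.
Local Notation g := (gdim V).
Implicit Types (u : nat -> 'M[C]_g) (L Y rho : 'M[C]_g).

Lemma mx_cvg_mul u L m p (A : 'M[C]_(m, g)) (B : 'M[C]_(g, p)) i j :
  mx_cvg u L -> cvgC (fun N => (A *m u N *m B) i j) ((A *m L *m B) i j).
Proof.
move=> cu; rewrite mulmx3E; apply: cvgC_eq (fun N => esym (mulmx3E A (u N) B i j)) _.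
apply: cvgC_sum => k; apply: cvgCM; apply: cvgC_sum => l; apply: cvgCM.
exact: cu.
Qed.

Lemma mx_cvg_submx u L Y : (forall N, (u N <= Y)%MS) -> mx_cvg u L -> (L <= Y)%MS.
Proof.
move=> uY cu; apply/submx_mulP => i j.
apply: cvgC_unique (mx_cvg_mul 1%:M (cokermx Y) i j cu) _.
by apply: cvgC_eq (cvgC_cst 0) => N; have /submx_mulP -> := uY N.
Qed.

Lemma mx_cvg_psd u L (N0 : nat) :
  (forall N : nat, (N0 <= N)%N -> psdmx (u N)) -> mx_cvg u L -> psdmx L.
Proof.
move=> pu cu v; apply: (@cvgC_ge0 _ _ N0) (mx_cvg_mul v (ctmx v) 0 0 cu).
by move=> N NN; apply: (pu N NN v).
Qed.

Lemma mx_cvg_unique u L L' : mx_cvg u L -> mx_cvg u L' -> L = L'.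
Proof. by move=> cL cL'; apply/matrixP=> i j; apply: cvgC_unique (cL i j) (cL' i j). Qed.

Lemma mx_cvg_lin a u u' L L' : mx_cvg u L -> mx_cvg u' L' ->
  mx_cvg (fun N => a *: u N + u' N) (a *: L + L').
Proof.
move=> cu cu' i j; have := cvgCD (cvgCM a (cu i j)) (cvgCM 1 (cu' i j)).
rewrite !mul1r => H.
suff -> : (a *: L + L') i j = a * L i j + L' i j.
  by apply: cvgC_eq H => N; rewrite !mxE mul1r.
by rewrite !mxE.
Qed.

Lemma mx_cvg_trace u L t : (forall N, \tr (u N) <= t) -> mx_cvg u L -> \tr L <= t.
Proof.
move=> ut cu; rewrite -subr_ge0.
apply: (@cvgC_ge0 (fun N => t - \tr (u N)) _ 0%N) => [N _|]; first by rewrite subr_ge0.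
apply: cvgCD (cvgC_cst t) _; rewrite -mulN1r.
have -> : \tr L = \sum_i L i i by [].
apply: cvgC_eq (cvgCM (-1) (cvgC_sum (index_enum 'I_g) (fun i => cu i i))) => N.
by rewrite mulN1r.
Qed.

Variables (P : 'M[C]_g) (pP : projmx P).
Local Notation Q := (orth P).

Definition exit_sum (Es : nat -> sop V) N rho : 'M[C]_g :=
  \sum_(k < N) Q *m loop_iter P Es k rho *m Q.

Variable Es : nat -> sop V.
Hypothesis cEs : forall k, contraction (Es k).

Lemma loop_posmap k : posmap (loop_iter P Es k).
Proof.
elim: k => [|k IH]; first exact: (contraction_id _ _).1.
exact: (posmap_comp (cEs k).1 (posmap_comp (posmap_proj pP) IH)).
Qed.

Lemma exit_posmap k : posmap (fun rho => Q *m loop_iter P Es k rho *m Q).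
Proof. exact: (posmap_comp (posmap_proj (projmx_orth pP)) (loop_posmap k)). Qed.

Lemma exit_sumS N rho :
  exit_sum Es N.+1 rho = exit_sum Es N rho + Q *m loop_iter P Es N rho *m Q.
Proof. exact: big_ord_recr. Qed.

Lemma exit_sum_posmap N : posmap (exit_sum Es N).
Proof. exact: (posmap_sum (fun k : 'I_N => exit_posmap k)). Qed.

(** A conservation law: what has left the loop plus what is still inside never exceeds the input.
    The second summand carries the induction. *)
Lemma exit_sum_trace N rho : psdmx rho ->
  \tr (exit_sum Es N rho) + \tr (loop_iter P Es N rho) <= \tr rho.
Proof.
move=> pr; elim: N => [|N IH].
  by rewrite [exit_sum _ _ _]big_ord0 mxtrace0 add0r.
rewrite exit_sumS mxtraceD -addrA; apply: le_trans IH; rewrite lerD2l.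
exact: (tni_branch pP (cEs N).2 ((loop_posmap N).2 _ pr)).
Qed.

Lemma exit_sum_le N rho : psdmx rho -> \tr (exit_sum Es N rho) <= \tr rho.
Proof.
move=> pr; apply: le_trans (exit_sum_trace N pr); rewrite lerDl.
by apply: psdmx_trace_ge0; apply: (loop_posmap N).2.
Qed.

Lemma exit_sum_cvg : exists E : sop V,
  forall rho, mx_cvg (fun N => exit_sum Es N rho) (E rho).
Proof.
suff H rho : exists L, mx_cvg (fun N => exit_sum Es N rho) L.
  exists (fun rho => ClassicalEpsilon.epsilon (inhabits 0)
            (mx_cvg (fun N => exit_sum Es N rho))) => rho.
  exact: ClassicalEpsilon.epsilon_spec.
(* A limit is required on every matrix, while monotone convergence needs a positive argument. *)
elim/rank1_span_ind: rho => [a A B [L cL] [L' cL']|v].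
  exists (a *: L + L'); have := mx_cvg_lin a cL cL'.
  by move=> H i j; apply: cvgC_eq (H i j) => N; rewrite (exit_sum_posmap N).1.
have pr := psdmx_gram v; move: (_ *m v) pr => rho pr.
have pd N : psdmx (exit_sum Es N.+1 rho - exit_sum Es N rho).
  by rewrite exit_sumS addrC addKr; apply: (exit_posmap N).2.
have H := psdmx_monotone_cvg pd (fun N => exit_sum_le N pr).
exists (\matrix_(i, j) ClassicalEpsilon.epsilon (inhabits 0)
    (cvgC (fun N => exit_sum Es N rho i j))) => i j.
rewrite mxE; exact: (ClassicalEpsilon.epsilon_spec _ _ (H i j)).
Qed.

Variable E : sop V.
Hypothesis cE : forall rho, mx_cvg (fun N => exit_sum Es N rho) (E rho).

Lemma exit_limit_contraction : contraction E.
Proof.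
apply: contraction_of => [a A B|rho pr].
  apply: mx_cvg_unique (cE _) _; have := mx_cvg_lin a (cE A) (cE B).
  by move=> H i j; apply: cvgC_eq (H i j) => N; rewrite (exit_sum_posmap N).1.
split; last exact: mx_cvg_trace (fun N => exit_sum_le N pr) (cE rho).
by apply: (@mx_cvg_psd _ _ 0%N) (cE rho) => N _; apply: (exit_sum_posmap N).2.
Qed.

Lemma exit_limit_submx rho Y :
  (forall k, (Q *m loop_iter P Es k rho *m Q <= Y)%MS) -> (E rho <= Y)%MS.
Proof.
move=> H; apply: mx_cvg_submx (cE rho) => N.
by apply: summx_sub => k _.
Qed.

Lemma exit_submx_limit k rho : psdmx rho ->
  (Q *m loop_iter P Es k rho *m Q <= E rho)%MS.
Proof.
move=> pr; apply: psdmx_le_submx; first exact: (exit_posmap k).2.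
(* The partial sum runs over [i < N], so it contains the [k]-th term from [N = k.+1] on. *)
apply: (@mx_cvg_psd (fun N => exit_sum Es N rho - Q *m loop_iter P Es k rho *m Q) _ k.+1).
  move=> N kN; rewrite /exit_sum (sum_subr_term (fun i => Q *m loop_iter P Es i rho *m Q) kN).
  by apply: psdmx_sum => i; apply: (exit_posmap i).2.
have cst : mx_cvg (fun=> Q *m loop_iter P Es k rho *m Q) (Q *m loop_iter P Es k rho *m Q).
  by move=> i j; apply: cvgC_cst.
have H := mx_cvg_lin (-1) cst (cE rho).
move=> i j; have := H i j; rewrite scaleN1r addrC => H'.
by apply: cvgC_eq H' => N; rewrite addrC.
Qed.

End Loops.

(** * Strongest postconditions *)

Lemma maps_into_psd (F : numClosedFieldType) n (D : ('M[F]_n -> 'M[F]_n) -> Prop)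
    (sigma Y : 'M[F]_n) : (forall E, D E -> posmap E) -> psdmx sigma ->
  maps_into D sigma Y <-> forall E, D E -> (E sigma <= Y)%MS.
Proof.
move=> posD ps; have hs := psdmx_adj ps; split=> H E DE; apply: submx_trans (H E DE).
  by apply: gram_posmap_supp (posD _ DE) ps _.
apply: posmap_supp (posD _ DE) ps _ (submxMl _ _).
exact: (psdmx_adj (psdmx_gram sigma)).
Qed.

Lemma psdmx_submx_addl (F : numClosedFieldType) n (A B : 'M[F]_n) :
  psdmx A -> psdmx B -> (A <= (A + B)%R)%MS.
Proof. by move=> pA pB; apply: psdmx_le_submx; rewrite // addrC addKr. Qed.

(** Triples test partial density operators only; this scaling brings the Gram matrix of any subspace
    among them. The [1] in [(1 + \tr A)^-1] covers [A = 0]. *)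
Lemma psdmx_normalize (F : numClosedFieldType) n (A : 'M[F]_n) : psdmx A ->
  exists2 c : F, 0 < c & psdmx (c *: A) /\ \tr (c *: A) <= 1.
Proof.
move=> pA; have t0 := psdmx_trace_ge0 pA.
have c0 : 0 < 1 + \tr A by rewrite ltr_wpDr.
exists (1 + \tr A)^-1; rewrite ?invr_gt0 //; split.
  by apply: psdmxZ => //; rewrite invr_ge0 ltW.
by rewrite mxtraceZ mulrC ler_pdivrMr // mul1r lerDr.
Qed.

Section Denotations.
Variable V : finType.
Local Notation g := (gdim V).
Implicit Types (S : prog V) (X Y Z : 'M[C]_g) (E : sop V).

Lemma ext_projmx (W : {set V}) (P : 'M[C]_(ldim W)) : is_proj P -> projmx (ext P).
Proof. exact: extmx_projmx. Qed.

Lemma den_contraction S : wf S -> forall E, den S E -> contraction E.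
Proof.
elim: S => [||W|W U|W P|W P Q|p S0 IH0 S1 IH1|S0 IH0 S1 IH1|W P S1 IH1 S0 IH0|W P S IH] /=.
- by move=> _ E ->; apply: contraction_id.
- by move=> _ E ->; apply: contraction0.
- by move=> _ E ->; apply: contraction_init.
- by move=> uU E ->; apply: contraction_unitary.
- by move=> pP E ->; apply/contraction_proj/ext_projmx.
- by move=> _ E [G [cG tG _ ->]]; apply: contraction_extmap.
- move=> [p01 [w0 w1]] E [E0 [E1 [d0 d1 ->]]].
  have {}p01 : 0 <= (p%:C)%C <= (1 : C) by rewrite !lecE /= !eqxx.
  have := contraction_mix p01 (IH0 w0 _ d0) (IH1 w1 _ d1).
  by apply: eq_contraction => X; rewrite raddfB.
- move=> [w0 w1] E [E0 [E1 [d0 d1 ->]]].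
  exact: contraction_comp (IH1 w1 _ d1) (IH0 w0 _ d0).
- move=> [pP [w1 w0]] E [E1 [E0 [d1 d0 ->]]].
  exact: contraction_branch (ext_projmx pP) (IH1 w1 _ d1) (IH0 w0 _ d0).
- move=> [pP w] E [Es [dEs cE]].
  exact: (exit_limit_contraction (ext_projmx pP) (fun k => IH w _ (dEs k)) cE).
Qed.

Lemma den_posmap S : wf S -> forall E, den S E -> posmap E.
Proof. by move=> w E /(den_contraction w) []. Qed.

Lemma while_run (W : {set V}) (P : 'M[C]_(ldim W)) S (Es : nat -> sop V) :
  is_proj P -> wf S -> (forall k, den S (Es k)) ->
  exists2 E, den (While W P S) E &
    forall rho, mx_cvg (fun N => exit_sum (ext P) Es N rho) (E rho).
Proof.
move=> pP w dEs.
have [E cE] := exit_sum_cvg (ext_projmx pP) (fun k => den_contraction w (dEs k)).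
by exists E => //; exists Es.
Qed.

(** Provides the fixed choices needed when only one component of a conditional or loop is varied;
    otherwise an empty denotation would make triples of the whole vacuous. *)
Lemma den_inhabited S : wf S -> exists E, den S E.
Proof.
elim: S => [||W|W U|W P|W P Q|p S0 IH0 S1 IH1|S0 IH0 S1 IH1|W P S1 IH1 S0 IH0|W P S IH] /=;
  try by move=> *; eexists.
- move=> _; exists (ext_sop (fun=> 0 : 'M[C]_(ldim W))); exists (fun=> 0).
  by have [c0 t0 s0] := specmx0 P Q; split.
- by move=> [_ [/IH0[E0 d0] /IH1[E1 d1]]]; eexists; exists E0, E1.
- by move=> [/IH0[E0 d0] /IH1[E1 d1]]; eexists; exists E0, E1.
- by move=> [_ [/IH1[E1 d1] /IH0[E0 d0]]]; eexists; exists E1, E0.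
- move=> [pP w]; have [E0 d0] := IH w.
  by have [E dE _] := while_run pP w (fun=> d0); exists E.
Qed.

Lemma hoare_maps_into S X Y : wf S -> hoare X S Y <-> maps_into (den S) X Y.
Proof.
move=> w; split=> [H E dE|H rho E [pr _] dE rX].
  have pE := den_posmap w dE; have [c c0 [pc tc]] := psdmx_normalize (psdmx_gram X).
  have cX : (c *: (ctmx X *m X) <= X)%MS by rewrite scalemx_sub ?submxMl.
  have := H _ E (conj pc tc) dE cX.
  by rewrite (linZ _ _ pE.1) /models eqmx_scale // gt_eqF.
apply: submx_trans (H E dE); exact: (gram_posmap_supp (den_posmap w dE) pr rX).
Qed.

(* Taking [<<_>>] makes [post S] depend only on the row space, so that equality of
   subspaces becomes Leibniz equality. *)
Definition post S X : 'M[C]_g :=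
  (<<ClassicalEpsilon.epsilon (inhabits (0 : 'M[C]_g))
      (fun Z => forall Y, maps_into (den S) X Y <-> (Z <= Y)%MS)>>)%MS.

Lemma post_maps_into S X Y : (post S X <= Y)%MS <-> maps_into (den S) X Y.
Proof.
have ex := sp_exists (den S) X; rewrite genmxE; apply: iff_sym.
exact: (ClassicalEpsilon.epsilon_spec _ _ ex).
Qed.

Lemma postP S X Y : wf S -> (post S X <= Y)%MS <-> hoare X S Y.
Proof.
by move=> w; apply: iff_trans (post_maps_into _ _ _) (iff_sym (hoare_maps_into _ _ w)).
Qed.

Lemma post_genmx S X Z : (forall Y, maps_into (den S) X Y <-> (Z <= Y)%MS) ->
  post S X = <<Z>>%MS.
Proof.
move=> H; rewrite -[LHS]genmx_id; apply/genmxP/andP; split.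
  exact/post_maps_into/H.
exact/H/post_maps_into.
Qed.

Lemma genmx_post S X : (<<post S X>>)%MS = post S X.
Proof. exact: genmx_id. Qed.

Lemma post_le S X X' : wf S -> (X <= X')%MS -> (post S X <= post S X')%MS.
Proof.
move=> w XX; apply/post_maps_into.
apply: (maps_into_le (den_posmap w) XX (submx_refl _)).
exact/post_maps_into.
Qed.

Lemma eq_post S X X' : wf S -> (X :=: X')%MS -> post S X = post S X'.
Proof.
move=> w XX; rewrite -[LHS]genmx_post -[RHS]genmx_post; apply/genmxP.
by rewrite !post_le ?XX.
Qed.

Lemma post_adds S X X' : wf S -> (post S (X + X')%MS <= post S X + post S X')%MS.
Proof.
move=> w; apply/post_maps_into/(maps_into_adds (den_posmap w)).
  exact/post_maps_into/addsmxSl.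
exact/post_maps_into/addsmxSr.
Qed.

Lemma wp_spec S Y : wf S -> exists Z, forall X, (post S X <= Y)%MS <-> (X <= Z)%MS.
Proof.
move=> w; have [Z HZ] := wp_exists (den_posmap w) Y.
by exists Z => X; apply: iff_trans (post_maps_into _ _ _) (HZ X).
Qed.

Lemma post_psd S sigma Y : wf S -> psdmx sigma ->
  (post S sigma <= Y)%MS <-> forall E, den S E -> (E sigma <= Y)%MS.
Proof.
move=> w ps; apply: iff_trans (post_maps_into _ _ _) _.
exact: maps_into_psd (den_posmap w) ps.
Qed.

Lemma post_seq S0 S1 X : wf S0 -> wf S1 -> post (Seq S0 S1) X = post S1 (post S0 X).
Proof.
move=> w0 w1; rewrite -[RHS]genmx_post; apply: post_genmx => Y.
(* [Z] absorbs the quantifier over the second map: the condition on [E1 (E0 _)] for all [E1] becomes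
   an inclusion of [E0 _] in [Z]. *)
have [Z HZ] := wp_spec Y w1.
have pE E0 : den S0 E0 -> psdmx (E0 (ctmx X *m X)).
  by move=> d0; apply: (den_posmap w0 d0).2; apply: psdmx_gram.
split=> [H|/HZ/post_maps_into H E [E0 [E1 [d0 d1 ->]]]].
  apply/HZ/post_maps_into => E0 d0; apply/HZ/(post_psd _ w1 (pE _ d0)) => E1 d1.
  by apply: (H (E1 \o E0)); exists E0, E1.
move: E1 d1; apply/(post_psd _ w1 (pE _ d0))/HZ.
exact: H.
Qed.

Lemma post_assert (W : {set V}) (P : 'M[C]_(ldim W)) X : is_proj P ->
  post (Assert W P) X = <<X *m ext P>>%MS.
Proof.
move=> pP; apply: post_genmx => Y; have [hP _] := ext_projmx pP.
have e : ext P *m (ctmx X *m X) *m ext P = ctmx (X *m ext P) *m (X *m ext P).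
  by rewrite ctmxM hP !mulmxA.
split=> [H|H E ->]; last by rewrite e gram_eqmx.
by rewrite -(gram_eqmx (X *m _)) -e; apply: (H (fun rho => ext P *m rho *m ext P)).
Qed.

Lemma post_cond (W : {set V}) (P : 'M[C]_(ldim W)) S1 S0 X :
  is_proj P -> wf S1 -> wf S0 -> post (Cond W P S1 S0) X =
  <<(post S1 (X *m ext P) + post S0 (X *m orth (ext P)))%MS>>%MS.
Proof.
move=> pP w1 w0; apply: post_genmx => Y; have [hP _] := ext_projmx pP.
have [hQ _] := projmx_orth (ext_projmx pP).
(* Fillers for the other branch: a sum of positive outputs dominates each summand, so each branch
   can be tested separately. *)
have [E1' d1'] := den_inhabited w1; have [E0' d0'] := den_inhabited w0.
have e : ext P *m (ctmx X *m X) *m ext P = ctmx (X *m ext P) *m (X *m ext P).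
  by rewrite ctmxM hP !mulmxA.
have e' : orth (ext P) *m (ctmx X *m X) *m orth (ext P) =
    ctmx (X *m orth (ext P)) *m (X *m orth (ext P)).
  by rewrite ctmxM hQ !mulmxA.
have pe (A : 'M[C]_g) : psdmx (ctmx A *m A) by exact: psdmx_gram.
rewrite addsmx_sub; split=> [H|/andP[H1 H0] E [E1 [E0 [d1 d0 ->]]]].
  have H' E1 E0 : den S1 E1 -> den S0 E0 ->
    ((E1 (ctmx (X *m ext P) *m (X *m ext P)) +
      E0 (ctmx (X *m orth (ext P)) *m (X *m orth (ext P))))%R <= Y)%MS.
    move=> d1 d0; rewrite -e -e'; apply: (H (fun rho => E1 (ext P *m rho *m ext P)
      + E0 (orth (ext P) *m rho *m orth (ext P)))).
    by exists E1, E0.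
  apply/andP; split; apply/post_maps_into => //.
    move=> E1 d1; apply: submx_trans (H' E1 E0' d1 d0').
    by apply: psdmx_submx_addl; [apply: (den_posmap w1 d1).2 | apply: (den_posmap w0 d0').2].
  move=> E0 d0; apply: submx_trans (H' E1' E0 d1' d0); rewrite addrC.
  by apply: psdmx_submx_addl; [apply: (den_posmap w0 d0).2 | apply: (den_posmap w1 d1').2].
rewrite e e'; apply: addmx_sub.
  by move: E1 d1; apply/post_maps_into.
by move: E0 d0; apply/post_maps_into.
Qed.

Lemma loop_iter_ext (P : 'M[C]_g) (Es Es' : nat -> sop V) k X :
  (forall j, (j < k)%N -> Es j = Es' j) -> loop_iter P Es k X = loop_iter P Es' k X.
Proof.
elim: k => //= k IH H; rewrite H // IH // => j jk.
exact/H/ltnW.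
Qed.

Definition loop_post S (P : 'M[C]_g) k X := iter k (fun Z => post S (Z *m P)) X.

(* The body may use a different element of its denotation in every round, so the
   last round can be chosen independently of the previous ones. *)
Lemma loop_postP S (P : 'M[C]_g) k X Y : wf S -> projmx P ->
  (loop_post S P k X <= Y)%MS <->
  forall Es, (forall j, den S (Es j)) -> (loop_iter P Es k (ctmx X *m X) <= Y)%MS.
Proof.
move=> w pP; have pL Es k' : (forall j, den S (Es j)) ->
    psdmx (loop_iter P Es k' (ctmx X *m X)).
  move=> dEs; apply: (loop_posmap pP (fun j => den_contraction w (dEs j)) k').2.
  exact: psdmx_gram.
elim: k Y => [|k IH] Y.
  have [E0 d0] := den_inhabited w.
  split=> [H Es _|/(_ (fun=> E0) (fun=> d0))]; rewrite /= ?gram_eqmx //.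
(* [Z] pulls [Y] back through the body and [Z'] pulls [Z] back through the guard, so round [k.+1]
   becomes an inclusion about round [k]. *)
have [Z HZ] := wp_spec Y w; have [Z' HZ'] := submx_preim g P Z.
have step Es : (forall j, den S (Es j)) ->
    (loop_iter P Es k (ctmx X *m X) <= Z')%MS <->
    forall E, den S E -> (E (P *m loop_iter P Es k (ctmx X *m X) *m P) <= Y)%MS.
  move=> dEs; set L := loop_iter _ _ _ _; have pLk : psdmx L by exact: pL.
  have pPL : psdmx (P *m L *m P) by apply: (posmap_proj pP).2.
  rewrite -HZ'; apply: iff_trans (iff_sym (HZ _)) _.
  suff -> : post S (L *m P) = post S (P *m L *m P) by exact: post_psd.
  apply: eq_post => //; apply/eqmxP; rewrite -mulmxA submxMl andbT.
  by have := psdmx_mul_submx P pLk; rewrite pP.1 mulmxA.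
split=> [H Es dEs|H].
  have /(step _ dEs) h : (loop_iter P Es k (ctmx X *m X) <= Z')%MS.
    by move: Es dEs; apply/IH; rewrite -HZ'; apply/HZ.
  exact: h (dEs k).
apply/HZ; rewrite HZ'; apply/IH => Es dEs; apply/(step Es dEs) => E dE.
pose Es' j := if (j < k)%N then Es j else E.
have e : loop_iter P Es' k (ctmx X *m X) = loop_iter P Es k (ctmx X *m X).
  by apply: loop_iter_ext => j jk; rewrite /Es' jk.
have eE : Es' k = E by rewrite /Es' ltnn.
rewrite -e -eE; apply: (H Es') => j; rewrite /Es'.
by case: ifP.
Qed.

Lemma post_while (W : {set V}) (P : 'M[C]_(ldim W)) S X Y : is_proj P -> wf S ->
  (post (While W P S) X <= Y)%MS <->
  forall k, (loop_post S (ext P) k X *m orth (ext P) <= Y)%MS.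
Proof.
move=> pP w; have pp := ext_projmx pP; have pQ := projmx_orth pp.
set Q := orth (ext P); have [Z HZ] := submx_preim g Q Y.
have pX : psdmx (ctmx X *m X) by exact: psdmx_gram.
apply: iff_trans (post_maps_into _ _ _) _; split=> [H k|H E [Es [dEs cE]]].
  rewrite HZ; apply/loop_postP => // Es dEs; rewrite -HZ.
  have cEs j := den_contraction w (dEs j).
  have [E dE cE] := while_run pP w dEs; apply: submx_trans (H E dE).
  apply: submx_trans (exit_submx_limit pp cEs cE k pX).
  have := psdmx_mul_submx Q ((loop_posmap pp cEs k).2 _ pX).
  by rewrite [ctmx Q]pQ.1.
apply: (exit_limit_submx cE) => k; rewrite -mulmxA mulmx_sub //.
have /(loop_postP _ _ _ w pp) h : (loop_post S (ext P) k X <= Z)%MS by rewrite -HZ.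
by rewrite HZ; apply: h.
Qed.

(** Refinement quantifies over projectors, while [post] takes any matrix; [proj_ortho] supplies a
    projector with the same row space, both for [X] and for its strongest postcondition. *)
Lemma pequiv_post S S' : wf S -> wf S' ->
  pequiv S S' <-> forall X, post S X = post S' X.
Proof.
move=> w w'; split=> [[r1 r2] X|H]; last first.
  by split=> P Q _ _ /(postP _ _ _) h; apply/postP => //; [rewrite -H|rewrite H]; exact: h.
have ref S1 S2 : wf S1 -> wf S2 -> refines S1 S2 -> (post S2 X <= post S1 X)%MS.
  move=> w1 w2 r; rewrite -(eq_post w2 (proj_orthoE X)) -(eq_post w1 (proj_orthoE X)).
  suff: (post S2 (proj_ortho X) <= proj_ortho (post S1 (proj_ortho X)))%MS.
    by rewrite proj_orthoE.
  apply/(postP _ _ w2).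
  apply: r; try exact: proj_ortho_projmx.
  by apply/(postP _ _ w1); rewrite proj_orthoE.
rewrite -[LHS]genmx_post -[RHS]genmx_post; apply/genmxP.
by rewrite (ref S' S) // (ref S S').
Qed.

End Denotations.

(** * The laws *)

Lemma eq_genmx_sub (F : fieldType) n (A B : 'M[F]_n) :
  (forall Y : 'M[F]_n, (A <= Y)%MS <-> (B <= Y)%MS) -> (<<A>> = <<B>>)%MS.
Proof.
by move=> H; apply/genmxP/andP; split; [apply/(H B) | apply/(H A)].
Qed.

Lemma genmx_mul (F : fieldType) n (A B : 'M[F]_n) : (<< <<A>> *m B >> = <<A *m B>>)%MS.
Proof. exact/eq_genmx/eqmxMr/genmxE. Qed.

(** After an assertion of [P], conjugation by an [M] fixing [P] is invisible, so only the scalar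
    remains. *)
Lemma extmap_absorb_pre (F : numClosedFieldType) (V : finType) (W : {set V})
    (P M : 'M[F]_(ldim W)) (X : 'M[F]_(gdim V)) c G : P *m M = P ->
  extmap (fun Z => c *: G (ctmx M *m Z *m M)) (ctmx (X *m extmx P) *m (X *m extmx P)) =
  c *: extmap G (ctmx (X *m extmx P) *m (X *m extmx P)).
Proof.
move=> PM; have e : extmx P *m extmx M = extmx P :> 'M[F]_(gdim V) by rewrite -extmxM PM.
by rewrite extmapZ extmap_pre -ctmx_ext mulmxA -ctmxM -!mulmxA e.
Qed.

(** Conjugation by [M] may distort the support of the output, but [M P = P] ensures that no vector
    is lost once it is seen through [P]. *)
Lemma extmap_absorb_post (F : numClosedFieldType) (V : finType) (W : {set V})
    (P M : 'M[F]_(ldim W)) (X : 'M[F]_(gdim V)) c G : projmx P -> M *m P = P ->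
  c != 0 -> psdmx (extmap G X) ->
  (extmap G X *m extmx P <= extmap (fun Z => c *: (ctmx M *m G Z *m M)) X *m extmx P)%MS.
Proof.
move=> pP MP c0; rewrite extmapZ extmap_post; move: (extmap G X) => L pL.
have e : extmx M *m extmx P = extmx P :> 'M[F]_(gdim V) by rewrite -extmxM MP.
have hP : ctmx (extmx P : 'M[F]_(gdim V)) = extmx P by exact: (extmx_projmx pP).1.
rewrite -scalemxAl eqmx_scale // -!mulmxA e.
apply: submx_trans (psdmx_mul_submx _ pL) _.
by rewrite -{1}e ctmxM hP ctmx_ext -!mulmxA submxMl.
Qed.

(** * Branches and loops for abstract subspace transformers *)

Section AbstractTransformers.
Variables (F : fieldType) (n : nat) (T T' : 'M[F]_n -> 'M[F]_n).
Implicit Types X Y Z : 'M[F]_n.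
Hypothesis eqT : forall X X', (X :=: X')%MS -> T X = T X'.

Lemma wpc_branch (r h q o Y : 'M[F]_n) :
  (forall Z, (<<T Z *m r>> = <<T (Z *m h) *m r>>)%MS) ->
  q *m (o *m h) = o *m h ->
  (T (Y *m o) *m r :=: T (Y *m q *m o *m h) *m r)%MS.
Proof.
move=> H e; have /genmxP /eqmxP := H (Y *m o).
by rewrite -!(mulmxA Y) -!mulmxA e.
Qed.

(** The iterates of the two loops need not agree, but they agree after multiplication by [q]. This
    suffices: the next round sees them through [a = q a] and the exit through [b = q b]. *)
Lemma wpc_loop (p q h a b X : 'M[F]_n) k :
  (forall Z, (<<T Z *m q>> = <<T (Z *m h) *m q>>)%MS) ->
  (forall Z, T' Z = (<<T (Z *m h) *m q>>)%MS) ->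
  p *m h = a -> q *m a = a -> q *m q = q -> q *m b = b ->
  (iter k (fun Z => T (Z *m p)) X *m b :=:
   iter k (fun Z => T' (Z *m p)) (X *m q) *m b)%MS.
Proof.
move=> H HT' ph qa qq qb; set A := iter k _ X; set A' := iter k _ (X *m q).
suff E : (A *m q :=: A' *m q)%MS by rewrite -qb !mulmxA; apply: eqmxMr.
rewrite {}/A {}/A'; elim: k => [|k IH] /=; first by rewrite -mulmxA qq.
move: (iter k _ X) (iter k _ (X *m q)) IH => A A' IH.
rewrite HT'; have /genmxP /eqmxP e := H (A *m p).
have -> : T (A' *m p *m h) = T (A *m p *m h).
  apply: eqT; rewrite -!mulmxA ph -qa !mulmxA.
  exact/eqmxMr/eqmx_sym.
apply: eqmx_trans e _; apply: eqmx_sym.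
by apply: eqmx_trans (eqmxMr _ (genmxE _)) _; rewrite -mulmxA qq.
Qed.

(** On [i] followed by the guard [p], the assertion [e] acts as the identity, so both loops have the
    same iterates. Staying inside [i] carries the induction and later absorbs the exit assertion. *)
Lemma spc_loop (p i e X : 'M[F]_n) k :
  i *m p *m e = i *m p -> i *m i = i ->
  (forall Z, T (Z *m e) = (<<T (Z *m e) *m i>>)%MS) ->
  (forall Z, T' Z = (<<T (Z *m e) *m i>>)%MS) ->
  iter k (fun Z => T (Z *m p)) (X *m i) = iter k (fun Z => T' (Z *m p)) (X *m i) /\
  (iter k (fun Z => T (Z *m p)) (X *m i) <= i)%MS.
Proof.
move=> ipe ii H HT'; elim: k => [|k [IH1 IH2]] /=; first by rewrite submxMl.
rewrite -IH1 HT' -H; move: (iter k _ _) IH2 => A /submxP[D eA].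
have -> : A *m p *m e = A *m p by rewrite eA -!mulmxA (mulmxA i) ipe.
split=> //; have -> : A *m p = A *m p *m e by rewrite eA -!mulmxA (mulmxA i) ipe.
by rewrite H genmxE submxMl.
Qed.

End AbstractTransformers.

Local Opaque post.

Section Laws.
Variables (V : finType) (W : {set V}).
Local Notation g := (gdim V).
Local Notation l := (ldim W).
Implicit Types (P Q R : 'M[C]_l) (S : prog V) (X Y : 'M[C]_g).

Lemma extM P Q : ext (P *m Q) = ext P *m ext Q :> 'M[C]_g.
Proof. exact: extmxM. Qed.

Lemma ext_orth P : ext (orth P) = orth (ext P) :> 'M[C]_g.
Proof. exact: extmx_orth. Qed.

Lemma orth_is_proj n (P : 'M[C]_n) : is_proj P -> is_proj (orth P).
Proof. exact: projmx_orth. Qed.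

Lemma sasaki_imp_is_proj P Q : is_proj (sasaki_imp P Q).
Proof. exact: proj_ortho_projmx. Qed.

Lemma sasaki_conj_is_proj P Q : is_proj (sasaki_conj P Q).
Proof. exact: proj_ortho_projmx. Qed.

Lemma ext_sasaki_imp P Q : is_proj P -> is_proj Q ->
  ext P *m ext (sasaki_imp P Q) = ext (pmeet P Q) :> 'M[C]_g.
Proof. by move=> pP pQ; rewrite -extM; congr ext; apply: sasaki_impM. Qed.

Lemma ext_pmeetr P Q : is_proj P -> is_proj Q ->
  ext Q *m ext (pmeet P Q) = ext (pmeet P Q) :> 'M[C]_g.
Proof.
by move=> pP pQ; rewrite -extM; congr ext; apply: mul_proj_ortho pQ (capmxSr _ _).
Qed.

Lemma ext_sasaki_conj P Q : is_proj P -> is_proj Q ->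
  ext Q *m ext P *m ext (sasaki_conj P Q) = ext Q *m ext P :> 'M[C]_g.
Proof. by move=> pP pQ; rewrite -!extM; congr ext; apply: sasaki_conjM. Qed.

Lemma ext_sasaki_conj_absorb P Q : is_proj P -> is_proj Q ->
  ext (sasaki_conj P Q) *m ext P *m ext Q = ext P *m ext Q :> 'M[C]_g.
Proof.
move=> pP pQ; rewrite -!extM; congr ext.
have -> : sasaki_conj P Q *m P = sasaki_conj P Q.
  by apply: projmx_submx pP _; rewrite proj_orthoE capmxSl.
exact: sasaki_conjMr.
Qed.

Lemma post_genmx_arg S X : wf S -> post S <<X>>%MS = post S X.
Proof. by move=> w; apply: eq_post => //; apply: genmxE. Qed.

Lemma post_assert_seq P S X : is_proj P -> wf S ->
  post (Seq (Assert W P) S) X = post S (X *m ext P).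
Proof. by move=> pP w; rewrite post_seq // post_assert // post_genmx_arg. Qed.

Lemma post_seq_assert P S X : is_proj P -> wf S ->
  post (Seq S (Assert W P)) X = <<post S X *m ext P>>%MS.
Proof. by move=> pP w; rewrite post_seq // post_assert. Qed.

(** [sp] is an epsilon choice, so its property rests on a witness: the orthogonal projector onto
    [post S X]. *)
Lemma hoare_sp S X : wf S -> hoare X S (sp S X).
Proof.
move=> w; suff [] : [/\ is_proj (sp S X), hoare X S (sp S X) &
  forall Y, is_proj Y -> hoare X S Y -> le (sp S X) Y] by [].
apply: (ClassicalEpsilon.epsilon_spec (inhabits 0) (fun Z : 'M[C]_g => [/\ is_proj Z, hoare X S Z &
  forall Y, is_proj Y -> hoare X S Y -> le Z Y])).
exists (proj_ortho (post S X)); split; first exact: proj_ortho_projmx.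
  by apply/(postP _ _ w); rewrite proj_orthoE.
by move=> Y _ /(postP _ _ w); rewrite /le proj_orthoE.
Qed.

Lemma hoare_wlp S Y : wf S -> hoare (wlp S Y) S Y.
Proof.
move=> w; suff [] : [/\ is_proj (wlp S Y), hoare (wlp S Y) S Y &
  forall X, is_proj X -> hoare X S Y -> le X (wlp S Y)] by [].
apply: (ClassicalEpsilon.epsilon_spec (inhabits 0) (fun Z : 'M[C]_g => [/\ is_proj Z, hoare Z S Y &
  forall X, is_proj X -> hoare X S Y -> le X Z])).
have [Z HZ] := wp_spec Y w.
exists (proj_ortho Z); split; first exact: proj_ortho_projmx.
  by apply/(postP _ _ w)/HZ; rewrite proj_orthoE.
by move=> X _ /(postP _ _ w)/HZ; rewrite /le proj_orthoE.
Qed.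

Lemma sp_wlp_post S X Y : wf S -> le (sp S X) Y \/ le X (wlp S Y) ->
  (post S X <= Y)%MS.
Proof.
move=> w [h|h].
  by apply: submx_trans h; apply/(postP _ _ w)/hoare_sp.
apply: submx_trans (post_le w h) _; exact/(postP _ _ w)/hoare_wlp.
Qed.

Lemma comm_asst_true S : wf S ->
  pequiv S (Seq (Assert W 1%:M) S) /\
  pequiv (Seq (Assert W 1%:M) S) (Seq S (Assert W 1%:M)).
Proof.
move=> w; have p1 : is_proj (1%:M : 'M[C]_l).
  by split; [apply: ctmx1 | rewrite mulmx1].
have e1 : ext (1%:M : 'M[C]_l) = 1%:M :> 'M[C]_g by exact: extmx1.
split; apply/pequiv_post => // X; rewrite post_assert_seq // e1 mulmx1 //.
by rewrite post_seq_assert // e1 mulmx1 genmx_post.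
Qed.

Lemma comm_asst_post P Q S : is_proj P -> is_proj Q -> wf S ->
  le (sp S (ext P)) (ext Q) \/ le (ext P) (wlp S (ext Q)) ->
  pequiv (Seq (Assert W P) S) (Seq (Seq (Assert W P) S) (Assert W Q)).
Proof.
move=> pP pQ w h; apply/pequiv_post => // X.
rewrite post_seq_assert // post_assert_seq //.
suff -> : post S (X *m ext P) *m ext Q = post S (X *m ext P) by rewrite genmx_post.
apply: projmx_submx (ext_projmx pQ) _.
by apply: submx_trans (sp_wlp_post w h); apply: post_le; rewrite // submxMl.
Qed.

Lemma comm_asst_pre P Q S : is_proj P -> is_proj Q -> wf S ->
  le (sp S (ext (orth P))) (ext (orth Q)) \/
  le (ext (orth P)) (wlp S (ext (orth Q))) ->
  pequiv (Seq S (Assert W Q)) (Seq (Seq (Assert W P) S) (Assert W Q)).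
Proof.
move=> pP pQ w /(sp_wlp_post w); rewrite !ext_orth => h; apply/pequiv_post => // X.
rewrite !post_seq_assert // post_assert_seq //.
have pp := ext_projmx pP; have pq := ext_projmx pQ.
(* Whatever lies in the complement of [P] is sent into the complement of [Q] and killed by the final
   assertion. [X] and [X P] differ only by such a part. *)
have key A B : (A <= B + orth (ext P))%MS -> (post S A *m ext Q <= post S B *m ext Q)%MS.
  move=> /(post_le w) AB; have := submx_trans AB (post_adds _ _ w).
  move=> /submx_trans /(_ (addsmxS (submx_refl _) h)) /(submxMr (ext Q)) /submx_trans; apply.
  rewrite addsmxMr addsmx_sub submx_refl /=.
  by rewrite mulmxBl mul1mx pq.2 subrr sub0mx.
apply/genmxP; rewrite !key //.
  have -> : X *m ext P = X + - X *m orth (ext P).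
    by rewrite mulNmx mulmxBr mulmx1 opprB addrCA subrr addr0.
  by rewrite addmx_sub_adds // submxMl.
have {1}-> : X = X *m ext P + X *m orth (ext P).
  by rewrite mulmxBr mulmx1 addrCA subrr addr0.
by rewrite addmx_sub_adds // submxMl.
Qed.

Lemma comm_asst_seq P Q R S1 S2 : is_proj P -> is_proj Q -> is_proj R ->
  wf S1 -> wf S2 ->
  pequiv (Seq (Assert W P) S1) (Seq (Seq (Assert W P) S1) (Assert W Q)) ->
  pequiv (Seq (Assert W Q) S2) (Seq (Seq (Assert W Q) S2) (Assert W R)) ->
  pequiv (Seq (Seq (Assert W P) S1) S2)
         (Seq (Seq (Seq (Seq (Assert W P) S1) (Assert W Q)) S2) (Assert W R)).
Proof.
move=> pP pQ pR w1 w2 /pequiv_post h1 /pequiv_post h2; apply/pequiv_post => // X.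
rewrite post_seq_assert // !(@post_seq _ _ S2) // -h1 //.
have := h1 (conj pP w1) (conj (conj pP w1) pQ) X; rewrite post_seq_assert //.
move: (post _ X) => A ->; rewrite post_genmx_arg //.
have := h2 (conj pQ w2) (conj (conj pQ w2) pR) A.
by rewrite post_seq_assert // post_assert_seq.
Qed.

(** * Laws on specification statements *)

Lemma den_spec P Q E : den (Spec W P Q) E <-> exists2 G, specmx P Q G & E = extmap G.
Proof.
by split=> [[G [c t s e]]|[G [c t s] e]]; exists G.
Qed.

(** Conjugating by [M] turns a map meeting the specification from [Q'] into one meeting it from [Q],
    with a proportional output on inputs that passed the assertion of [P]. *)
Lemma post_spec_pre P Q Q' R M X : is_proj P -> is_proj Q -> is_proj Q' -> is_proj R ->
  P *m M = P -> (Q *m M <= Q')%MS ->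
  (post (Spec W Q' R) (X *m ext P) <= post (Spec W Q R) (X *m ext P))%MS.
Proof.
move=> pP pQ pQ' pR PM QM; apply/post_maps_into => E /den_spec[G sG ->].
have [c c0 sG'] := specmx_pre QM sG.
have : den (Spec W Q R) (extmap (fun Z => c *: G (ctmx M *m Z *m M))).
  by apply/den_spec; exists (fun Z => c *: G (ctmx M *m Z *m M)).
set Y := post _ _; have /post_maps_into H : (Y <= Y)%MS by [].
by move=> /H; rewrite [extmap _ _](extmap_absorb_pre X c G PM) eqmx_scale.
Qed.

Lemma wpc_asst_pres P Q R : is_proj P -> is_proj Q -> is_proj R ->
  pequiv (Seq (Assert W P) (Spec W Q R))
         (Seq (Assert W P) (Spec W (sasaki_imp P Q) R)).
Proof.
move=> pP pQ pR; have pH := sasaki_imp_is_proj P Q; apply/pequiv_post => // X.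
rewrite !post_assert_seq // -[LHS]genmx_post -[RHS]genmx_post; apply/genmxP/andP; split.
  (* [M = P] serves in this direction, because [P] maps the Sasaki implication onto the meet, which
     lies in [Q]. *)
  apply: (@post_spec_pre _ _ _ _ P) => //; first exact: pP.2.
  have HP : sasaki_imp P Q *m P = pmeet P Q.
    have := congr1 (@ctmx _ _ _) (sasaki_impM pP pQ); rewrite ctmxM.
    have hM : ctmx (pmeet P Q) = pmeet P Q by exact: (proj_ortho_projmx _).1.
    have hP : ctmx P = P by exact: pP.1.
    have hH : ctmx (sasaki_imp P Q) = sasaki_imp P Q by exact: pH.1.
    by rewrite -/(sasaki_imp P Q) hP => e; rewrite -{1}hH; apply: etrans e hM.
  by rewrite HP proj_orthoE capmxSr.
(* The orthogonal projector [P] can send [Q] outside the meet of [P] and [Q], so an oblique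
   projection is taken here. *)
have [M [PM QM]] := oblique_proj P Q.
apply: (@post_spec_pre _ _ _ _ M) => //; apply: submx_trans QM _.
by rewrite proj_orthoE (submx_trans _ (addsmxSr _ _)) // proj_orthoE.
Qed.

Lemma post_spec_post P Q R R' M X : is_proj P -> is_proj Q -> is_proj R -> is_proj R' ->
  M *m P = P -> (R' *m M <= R)%MS ->
  (post (Spec W Q R') X *m ext P <= post (Spec W Q R) X *m ext P)%MS.
Proof.
move=> pP pQ pR pR' MP RM; have w : wf (Spec W Q R') by [].
set Y := post (Spec W Q R) X; have [Z HZ] := submx_preim g (ext P) (Y *m ext P).
rewrite HZ; apply/post_maps_into => E dE; have pE := den_posmap w dE.
move: dE pE => /den_spec[G sG ->] pE; rewrite -HZ.
have [c c0 sG'] := specmx_post RM sG.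
have pGX : psdmx (extmap G (ctmx X *m X)) by apply: pE.2; apply: psdmx_gram.
apply: submx_trans (extmap_absorb_post pP MP c0 pGX) _; apply: submxMr.
have /post_maps_into H : (Y <= Y)%MS by [].
by apply: H; apply/den_spec; exists (fun Z => c *: (ctmx M *m G Z *m M)).
Qed.

Lemma spc_asst_pres P Q R : is_proj P -> is_proj Q -> is_proj R ->
  pequiv (Seq (Spec W Q R) (Assert W P))
         (Seq (Spec W Q (sasaki_conj P R)) (Assert W P)).
Proof.
move=> pP pQ pR; have pH := sasaki_conj_is_proj P R; apply/pequiv_post => // X.
rewrite !post_seq_assert //; apply/genmxP/andP; split.
  apply: (@post_spec_post _ _ _ _ P) => //; first exact: pP.2.
  exact: sub_sasaki_conj.
(* The Sasaki conjunction is spanned by [R P], whose vectors need not lie in [R]; [M] moves them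
   back into [R] without changing what [P] sees. *)
have [M [MP RM]] := oblique_lift R pP.
apply: (@post_spec_post _ _ _ _ M) => //; apply: submx_trans RM.
by apply: submxMr; apply: sasaki_conj_sub.
Qed.

(** * Laws on conditionals, loops and repeated assertions *)

Lemma wf_seq S S' : wf S -> wf S' -> wf (Seq S S').
Proof. by []. Qed.

Lemma wf_assert P : is_proj P -> wf (Assert W P).
Proof. by []. Qed.

Lemma wf_cond P S1 S0 : is_proj P -> wf S1 -> wf S0 -> wf (Cond W P S1 S0).
Proof. by []. Qed.

Lemma wf_while P S : is_proj P -> wf S -> wf (While W P S).
Proof. by []. Qed.

Lemma post_body P Q S X : is_proj P -> is_proj Q -> wf S ->
  post (Seq (Seq (Assert W P) S) (Assert W Q)) X = <<post S (X *m ext P) *m ext Q>>%MS.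
Proof.
move=> pP pQ w; rewrite (post_seq_assert X pQ (wf_seq (wf_assert pP) w)).
by rewrite (post_assert_seq X pP w).
Qed.

Lemma wf_body P Q S : is_proj P -> is_proj Q -> wf S ->
  wf (Seq (Seq (Assert W P) S) (Assert W Q)).
Proof. by []. Qed.

Lemma pequiv_body_wpc P Q S X : is_proj P -> is_proj Q -> wf S ->
  pequiv (Seq S (Assert W Q)) (Seq (Seq (Assert W P) S) (Assert W Q)) ->
  (<<post S X *m ext Q>> = <<post S (X *m ext P) *m ext Q>>)%MS.
Proof.
move=> pP pQ w /(pequiv_post (wf_seq w (wf_assert pQ)) (wf_body pP pQ w)) /(_ X).
by rewrite (post_seq_assert X pQ w) (post_body X pP pQ w).
Qed.

Lemma pequiv_body_spc P Q S X : is_proj P -> is_proj Q -> wf S ->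
  pequiv (Seq (Assert W P) S) (Seq (Seq (Assert W P) S) (Assert W Q)) ->
  post S (X *m ext P) = <<post S (X *m ext P) *m ext Q>>%MS.
Proof.
move=> pP pQ w /(pequiv_post (wf_seq (wf_assert pP) w) (wf_body pP pQ w)) /(_ X).
by rewrite (post_assert_seq X pP w) (post_body X pP pQ w).
Qed.

(** The Sasaki formulas enter through two identities: [Q] fixes the products of each guard with its
    branch assertion, which in the law are the meets of [P] and of its complement with [Q]. *)
Lemma cond_wpc P Q R H1 H0 S1 S0 : is_proj P -> is_proj Q -> is_proj R ->
  is_proj H1 -> is_proj H0 -> wf S1 -> wf S0 ->
  ext Q *m (ext P *m ext H1) = ext P *m ext H1 :> 'M[C]_g ->
  ext Q *m (orth (ext P) *m ext H0) = orth (ext P) *m ext H0 :> 'M[C]_g ->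
  pequiv (Seq S1 (Assert W R)) (Seq (Seq (Assert W H1) S1) (Assert W R)) ->
  pequiv (Seq S0 (Assert W R)) (Seq (Seq (Assert W H0) S0) (Assert W R)) ->
  pequiv (Seq (Cond W P S1 S0) (Assert W R))
         (Seq (Seq (Assert W Q) (Cond W P (Seq (Assert W H1) S1)
                                          (Seq (Assert W H0) S0))) (Assert W R)).
Proof.
move=> pP pQ pR pH1 pH0 w1 w0 e1 e0 h1 h0.
have wA1 := wf_seq (wf_assert pH1) w1; have wA0 := wf_seq (wf_assert pH0) w0.
have wl := wf_cond pP w1 w0; have wr := wf_cond pP wA1 wA0.
apply/(pequiv_post (wf_seq wl (wf_assert pR)) (wf_body pQ pR wr)) => X.
rewrite (post_seq_assert X pR wl) (post_body X pQ pR wr).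
rewrite (post_cond _ pP w1 w0) (post_cond _ pP wA1 wA0).
rewrite (post_assert_seq _ pH1 w1) (post_assert_seq _ pH0 w0).
apply: etrans (genmx_mul _ _) (etrans _ (esym (genmx_mul _ _))); apply: eq_genmx.
have k1 : (post S1 (X *m ext P) *m ext R :=:
    post S1 (X *m ext Q *m ext P *m ext H1) *m ext R)%MS.
  apply: wpc_branch e1 => Z; exact: pequiv_body_wpc h1.
have k0 : (post S0 (X *m orth (ext P)) *m ext R :=:
    post S0 (X *m ext Q *m orth (ext P) *m ext H0) *m ext R)%MS.
  apply: wpc_branch e0 => Z; exact: pequiv_body_wpc h0.
apply: eqmx_trans (addsmxMr _ _ _) _; apply: eqmx_trans (adds_eqmx k1 k0) _.
exact: eqmx_sym (addsmxMr _ _ _).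
Qed.

Lemma while_wpc P Q H G A B S : is_proj P -> is_proj Q -> is_proj H -> is_proj G ->
  wf S -> ext P *m ext H = A :> 'M[C]_g -> ext Q *m A = A ->
  orth (ext P) *m ext G = B :> 'M[C]_g -> ext Q *m B = B ->
  pequiv (Seq S (Assert W Q)) (Seq (Seq (Assert W H) S) (Assert W Q)) ->
  pequiv (Seq (While W P S) (Assert W G))
         (Seq (Seq (Assert W Q)
                   (While W P (Seq (Seq (Assert W H) S) (Assert W Q)))) (Assert W G)).
Proof.
move=> pP pQ pH pG w eA qA eB qB h; have wb := wf_body pH pQ w.
have [pq1 pq2] := ext_projmx pQ; have [wl wr] := (wf_while pP w, wf_while pP wb).
apply/(pequiv_post (wf_seq wl (wf_assert pG)) (wf_body pQ pG wr)) => X.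
rewrite (post_seq_assert X pG wl) (post_body X pQ pG wr).
apply: eq_genmx_sub => Y; have [Z HZ] := submx_preim g (ext G) Y; rewrite !HZ.
have k N : (loop_post S (ext P) N X *m B :=:
    loop_post (Seq (Seq (Assert W H) S) (Assert W Q)) (ext P) N (X *m ext Q) *m B)%MS.
  have eqT (X1 X2 : 'M[C]_g) : (X1 :=: X2)%MS -> post S X1 = post S X2 by exact: eq_post w.
  exact: (wpc_loop eqT X N (fun Z => pequiv_body_wpc Z pH pQ w h)
           (fun Z => post_body Z pH pQ w) eA qA pq2 qB).
apply: iff_trans (post_while X Z pP w) _.
apply: iff_trans _ (iff_sym (post_while (X *m ext Q) Z pP wb)).
by split=> hk N; have := hk N; rewrite -!HZ -!mulmxA eB k.
Qed.

Lemma asst_post P Q E E' : is_proj P -> is_proj Q -> is_proj E -> is_proj E' ->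
  ext P *m ext Q *m ext E = ext P *m ext Q :> 'M[C]_g ->
  ext E' *m ext P *m ext Q = ext P *m ext Q :> 'M[C]_g ->
  pequiv (Seq (Assert W P) (Assert W Q))
         (Seq (Seq (Assert W P) (Assert W Q)) (Assert W E)) /\
  pequiv (Seq (Seq (Assert W P) (Assert W Q)) (Assert W E))
         (Seq (Seq (Assert W E') (Assert W P)) (Assert W Q)).
Proof.
move=> pP pQ pE pE' e e'.
have [aP aQ] := (wf_assert pP, wf_assert pQ).
have f X : post (Seq (Assert W P) (Assert W Q)) X = (<<X *m ext P *m ext Q>>)%MS.
  by rewrite (post_assert_seq X pP aQ) (post_assert _ pQ).
have fE X : post (Seq (Seq (Assert W P) (Assert W Q)) (Assert W E)) X =
    (<<X *m ext P *m ext Q>>)%MS.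
  rewrite (post_body X pP pE aQ) (post_assert _ pQ) genmx_mul.
  by rewrite -!(mulmxA X) e.
split; [apply/(pequiv_post (wf_seq aP aQ) (wf_body pP pE aQ)) => X|
        apply/(pequiv_post (wf_body pP pE aQ) (wf_body pE' pQ aP)) => X]; rewrite fE.
  exact: f.
rewrite (post_body X pE' pQ aP) (post_assert _ pP) genmx_mul.
by rewrite -!(mulmxA X) e'.
Qed.

Lemma cond_spc P Q R E1 E0 S1 S0 : is_proj P -> is_proj Q -> is_proj R ->
  is_proj E1 -> is_proj E0 -> wf S1 -> wf S0 ->
  ext Q *m ext P *m ext E1 = ext Q *m ext P :> 'M[C]_g ->
  ext Q *m orth (ext P) *m ext E0 = ext Q *m orth (ext P) :> 'M[C]_g ->
  pequiv (Seq (Assert W E1) S1) (Seq (Seq (Assert W E1) S1) (Assert W R)) ->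
  pequiv (Seq (Assert W E0) S0) (Seq (Seq (Assert W E0) S0) (Assert W R)) ->
  pequiv (Seq (Assert W Q) (Cond W P S1 S0))
         (Seq (Seq (Assert W Q) (Cond W P (Seq (Assert W E1) S1)
                                          (Seq (Assert W E0) S0))) (Assert W R)).
Proof.
move=> pP pQ pR pE1 pE0 w1 w0 e1 e0 h1 h0.
have wA1 := wf_seq (wf_assert pE1) w1; have wA0 := wf_seq (wf_assert pE0) w0.
have wl := wf_cond pP w1 w0; have wr := wf_cond pP wA1 wA0.
apply/(pequiv_post (wf_seq (wf_assert pQ) wl) (wf_body pQ pR wr)) => X.
have f1 : X *m ext Q *m ext P *m ext E1 = X *m ext Q *m ext P.
  by rewrite -!(mulmxA X) e1.
have f0 : X *m ext Q *m orth (ext P) *m ext E0 = X *m ext Q *m orth (ext P).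
  by rewrite -!(mulmxA X) e0.
rewrite (post_assert_seq X pQ wl) (post_body X pQ pR wr).
rewrite (post_cond _ pP w1 w0) (post_cond _ pP wA1 wA0).
rewrite (post_assert_seq _ pE1 w1) (post_assert_seq _ pE0 w0) f1 f0 genmx_mul.
have := pequiv_body_spc (X *m ext Q *m ext P) pE1 pR w1 h1; rewrite f1 => k1.
have := pequiv_body_spc (X *m ext Q *m orth (ext P)) pE0 pR w0 h0; rewrite f0 => k0.
apply: eq_genmx; apply: eqmx_trans _ (eqmx_sym (addsmxMr _ _ _)).
by apply: adds_eqmx; [rewrite {1}k1 | rewrite {1}k0]; apply: genmxE.
Qed.

Lemma while_spc P I E G S : is_proj P -> is_proj I -> is_proj E -> is_proj G -> wf S ->
  ext I *m ext P *m ext E = ext I *m ext P :> 'M[C]_g ->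
  ext I *m orth (ext P) *m ext G = ext I *m orth (ext P) :> 'M[C]_g ->
  pequiv (Seq (Assert W E) S) (Seq (Seq (Assert W E) S) (Assert W I)) ->
  pequiv (Seq (Assert W I) (While W P S))
         (Seq (Seq (Assert W I)
                   (While W P (Seq (Seq (Assert W E) S) (Assert W I)))) (Assert W G)).
Proof.
move=> pP pI pE pG w eE eG h; have wb := wf_body pE pI w.
have [_ ii] := ext_projmx pI; have [wl wr] := (wf_while pP w, wf_while pP wb).
apply/(pequiv_post (wf_seq (wf_assert pI) wl) (wf_body pI pG wr)) => X.
rewrite (post_assert_seq X pI wl) (post_body X pI pG wr) -[LHS]genmx_post.
apply: eq_genmx_sub => Y; have [Z HZ] := submx_preim g (ext G) Y; rewrite HZ.
have k N : loop_post S (ext P) N (X *m ext I) =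
    loop_post (Seq (Seq (Assert W E) S) (Assert W I)) (ext P) N (X *m ext I) /\
    (loop_post S (ext P) N (X *m ext I) <= ext I)%MS.
  exact: (spc_loop X N eE ii (fun Z => pequiv_body_spc Z pE pI w h)
            (fun Z => post_body Z pE pI w)).
apply: iff_trans (post_while (X *m ext I) Y pP w) _.
apply: iff_trans _ (iff_sym (post_while (X *m ext I) Z pP wb)).
(* Every iterate stays in [I], so each exit term is already fixed by the final assertion [G]. *)
have kG N : loop_post S (ext P) N (X *m ext I) *m orth (ext P) *m ext G =
    loop_post S (ext P) N (X *m ext I) *m orth (ext P).
  by have [_ /submxP[D ->]] := k N; rewrite -!(mulmxA D) eG.
by split=> hk N; have := hk N; rewrite -!HZ -(k N).1 kG.
Qed.

End Laws.

Theorem theorem4p7 (V : finType) (W : {set V})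
  (P Q R Inv : 'M[C]_(ldim W))
  (hP : is_proj P) (hQ : is_proj Q) (hR : is_proj R) (hInv : is_proj Inv)
  (S S0 S1 S2 : prog V)
  (wS : wf S) (wS0 : wf S0) (wS1 : wf S1) (wS2 : wf S2) :
  (* (Comm-Asst-True) *)
  (pequiv S (Seq (Assert W 1%:M) S) /\
   pequiv (Seq (Assert W 1%:M) S) (Seq S (Assert W 1%:M))) /\
  (* (Comm-Asst-Post) *)
  ((le (sp S (ext P)) (ext Q) \/ le (ext P) (wlp S (ext Q))) ->
   pequiv (Seq (Assert W P) S) (Seq (Seq (Assert W P) S) (Assert W Q))) /\
  (* (Comm-Asst-Pre) *)
  ((le (sp S (ext (orth P))) (ext (orth Q)) \/
    le (ext (orth P)) (wlp S (ext (orth Q)))) ->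
   pequiv (Seq S (Assert W Q)) (Seq (Seq (Assert W P) S) (Assert W Q))) /\
  (* (Comm-Asst-Seq) *)
  (pequiv (Seq (Assert W P) S1) (Seq (Seq (Assert W P) S1) (Assert W Q)) ->
   pequiv (Seq (Assert W Q) S2) (Seq (Seq (Assert W Q) S2) (Assert W R)) ->
   pequiv (Seq (Seq (Assert W P) S1) S2)
          (Seq (Seq (Seq (Seq (Assert W P) S1) (Assert W Q)) S2) (Assert W R))) /\
  (* (Wpc-Asst-Pres) *)
  pequiv (Seq (Assert W P) (Spec W Q R))
         (Seq (Assert W P) (Spec W (sasaki_imp P Q) R)) /\
  (* (Wpc-Asst-Cond) *)
  (pequiv (Seq S1 (Assert W R))
          (Seq (Seq (Assert W (sasaki_imp P Q)) S1) (Assert W R)) ->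
   pequiv (Seq S0 (Assert W R))
          (Seq (Seq (Assert W (sasaki_imp (orth P) Q)) S0) (Assert W R)) ->
   pequiv (Seq (Cond W P S1 S0) (Assert W R))
          (Seq (Seq (Assert W Q)
                    (Cond W P (Seq (Assert W (sasaki_imp P Q)) S1)
                              (Seq (Assert W (sasaki_imp (orth P) Q)) S0)))
               (Assert W R))) /\
  (* (Wpc-Asst-While) *)
  (pequiv (Seq S (Assert W Q))
          (Seq (Seq (Assert W (sasaki_imp P Q)) S) (Assert W Q)) ->
   pequiv (Seq (While W P S) (Assert W (sasaki_imp (orth P) Q)))
          (Seq (Seq (Assert W Q)
                    (While W P (Seq (Seq (Assert W (sasaki_imp P Q)) S)
                                    (Assert W Q))))
               (Assert W (sasaki_imp (orth P) Q)))) /\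
  (* (Spc-Asst-Post) *)
  (pequiv (Seq (Assert W P) (Assert W Q))
          (Seq (Seq (Assert W P) (Assert W Q)) (Assert W (sasaki_conj Q P))) /\
   pequiv (Seq (Seq (Assert W P) (Assert W Q)) (Assert W (sasaki_conj Q P)))
          (Seq (Seq (Assert W (sasaki_conj P Q)) (Assert W P)) (Assert W Q))) /\
  (* (Spc-Asst-Pres) *)
  pequiv (Seq (Spec W Q R) (Assert W P))
         (Seq (Spec W Q (sasaki_conj P R)) (Assert W P)) /\
  (* (Spc-Asst-Cond) *)
  (pequiv (Seq (Assert W (sasaki_conj P Q)) S1)
          (Seq (Seq (Assert W (sasaki_conj P Q)) S1) (Assert W R)) ->
   pequiv (Seq (Assert W (sasaki_conj (orth P) Q)) S0)
          (Seq (Seq (Assert W (sasaki_conj (orth P) Q)) S0) (Assert W R)) ->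
   pequiv (Seq (Assert W Q) (Cond W P S1 S0))
          (Seq (Seq (Assert W Q)
                    (Cond W P (Seq (Assert W (sasaki_conj P Q)) S1)
                              (Seq (Assert W (sasaki_conj (orth P) Q)) S0)))
               (Assert W R))) /\
  (* (Spc-Asst-While) *)
  (pequiv (Seq (Assert W (sasaki_conj P Inv)) S)
          (Seq (Seq (Assert W (sasaki_conj P Inv)) S) (Assert W Inv)) ->
   pequiv (Seq (Assert W Inv) (While W P S))
          (Seq (Seq (Assert W Inv)
                    (While W P (Seq (Seq (Assert W (sasaki_conj P Inv)) S)
                                    (Assert W Inv))))
               (Assert W (sasaki_conj (orth P) Inv)))).
Proof.
have pO := orth_is_proj hP.
have eO := ext_orth P; have eH1 := ext_sasaki_imp hP hQ; have eH0 := ext_sasaki_imp pO hQ.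
have qA1 := ext_pmeetr hP hQ; have qA0 := ext_pmeetr pO hQ.
have pi1 := sasaki_imp_is_proj P Q; have pi0 := sasaki_imp_is_proj (orth P) Q.
have pc1 := sasaki_conj_is_proj P Q; have pc0 := sasaki_conj_is_proj (orth P) Q.
have pcI := sasaki_conj_is_proj P Inv; have pcI0 := sasaki_conj_is_proj (orth P) Inv.
have ec1 := ext_sasaki_conj hP hQ; have ec0 := ext_sasaki_conj pO hQ.
have ecI := ext_sasaki_conj hP hInv; have ecI0 := ext_sasaki_conj pO hInv.
rewrite !eO in eH0 ec0 ecI0.
split; first exact: comm_asst_true wS.
split; first exact: comm_asst_post hP hQ wS.
split; first exact: comm_asst_pre hP hQ wS.
split; first exact: comm_asst_seq hP hQ hR wS1 wS2.
split; first exact: wpc_asst_pres hP hQ hR.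
split.
  apply: (cond_wpc hP hQ hR pi1 pi0 wS1 wS0); first by rewrite eH1; exact: qA1.
  by rewrite eH0; exact: qA0.
split; first exact: (while_wpc hP hQ pi1 pi0 wS eH1 qA1 eH0 qA0).
split.
  apply: (asst_post hP hQ (sasaki_conj_is_proj Q P) pc1); first exact: ext_sasaki_conj.
  exact: ext_sasaki_conj_absorb.
split; first exact: spc_asst_pres hP hQ hR.
split; first exact: (cond_spc hP hQ hR pc1 pc0 wS1 wS0 ec1 ec0).
exact: (while_spc hP hInv pcI pcI0 wS ecI ecI0).
Qed.
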